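(* Assume (F0)–(F6), with (F3') in place of (F3). For each $\epsilon>0$ let $u_\epsilon:[0,T]\to X$ be the solution, for given initial data at $t=0$, of $$\epsilon^2A\ddot u_\epsilon(t)+\epsilon B\dot u_\epsilon(t)+\nabla_xF(t,u_\epsilon(t))=0,\qquad t\in[0,T],$$ with $u_\epsilon(0)$ uniformly bounded and $\epsilon\dot u_\epsilon(0)\to0$ as $\epsilon\to0$. Let $u:[0,T]\to X$ be a regulated function which is the pointwise limit on $[0,T]$ of $u_\epsilon$ along some sequence $\epsilon\to0$ independent of $t$, and let $J$ be the jump set of $u$. Then there exists a positive atomic measure $\mu$ on $[0,T]$, with $\operatorname{supp}(\mu)=J$, such that $$F(t,u_+(t))+\mu([s,t])=F(s,u_-(s))+\int_s^t\partial_rF(r,u(r))\,dr$$ for all $0\le s\le t\le T$.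
   Context: Setting: $T>0$; $(X,\|\cdot\|)$ is a Euclidean space of dimension $n\ge1$ with inner product $\langle\cdot,\cdot\rangle$; $A,B:X\to X$ are symmetric, positive definite linear operators; $F:[0,T]\times X\to\mathbb{R}$. Regulated function: $u:[0,T]\to X$ such that at each $s\in[0,T]$ the one-sided limits $u_+(s)=\lim_{h\to0^+}u(s+h)$ and $u_-(s)=\lim_{h\to0^-}u(s+h)$ exist (where they make sense). Conventions: $u_-(0):=u(0)$ and $u_+(T):=u(T)$. The jump set is $J=\{t\in[0,T]:u_-(t)\ne u_+(t)\}$; it is at most countable. For the atomic measure $\mu$, $\operatorname{supp}(\mu)$ means the set of atoms, i.e. $\mu$ is concentrated on $J$ and $\mu(\{t\})>0$ exactly for $t\in J$. (Under the stated assumptions a sequence $\epsilon\to0$ and a regulated pointwise limit $u$ exist, by the paper's compactness theorem.) Assumptions on $F$: (F0) $F\in C^1([0,T]\times X)$. (F1) For every $\rho>0$ the set $\{u\in X:\sup_{t\in[0,T]}|F(t,u)|\le\rho\}$ is bounded. (F2) There exist $C_1,C_2>0$ with $|\partial_tF(t,u)|\le C_1F(t,u)+C_2$ for all $(t,u)\in[0,T]\times X$. (F3') For fixed $u\in X$, the function $t\mapsto\nabla_xF(t,u)$ is Lipschitz continuous on $[0,T]$, locally uniformly with respect to $u$ (this replaces (F3), which would only ask $|\partial_t\nabla_xF(t,u)|\le a_M(t)$ on $\|u\|\le M$ with $a_M\in L^1(0,T)$). (F4) $F(t,\cdot)\in C^2(X)$ for every $t\in[0,T]$ and the Hessian $\nabla_x^2F(t,u)$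 is continuous on $[0,T]\times X$. (F5) For every $t\in[0,T]$ the critical set $\mathcal{C}(t):=\{u\in X:\nabla_xF(t,u)=0\}$ consists of isolated points. (F6) For every $t\in[0,T]$ and every $u\in\mathcal{C}(t)$, $\displaystyle\liminf_{v\to u}\frac{F(t,v)-F(t,u)}{\|\nabla_xF(t,v)\|}\ge0$. *)

(* Defs.v *)
From HB Require Import structures.
From mathcomp Require Import all_boot all_order all_algebra.
From mathcomp Require Import all_classical all_reals all_analysis.

Set Implicit Arguments.
Unset Strict Implicit.
Unset Printing Implicit Defensive.

Import Order.TTheory GRing.Theory Num.Theory.
Import numFieldNormedType.Exports.

Local Open Scope classical_set_scope.
Local Open Scope ring_scope.

(* X is a Euclidean space of dimension n: [ip] is an inner product inducing the
   norm of X (positive definiteness follows from [euclidean_norm]), and X has a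
   basis of n vectors. *)
Record euclidean (R : realType) (X : normedModType R) (ip : X -> X -> R)
    (n : nat) : Prop := Euclidean {
  euclidean_sym : forall x y, ip x y = ip y x;
  euclidean_linear : forall a x y z, ip (a *: x + y) z = a * ip x z + ip y z;
  euclidean_norm : forall x, `|x| = Num.sqrt (ip x x);
  euclidean_dim : exists b : 'I_n -> X, forall x,
    exists! c : 'rV[R]_n, x = \sum_(i < n) c ord0 i *: b i }.

Definition sym_posdef (R : realType) (X : normedModType R) (ip : X -> X -> R)
    (A : X -> X) : Prop :=
  (forall x y, ip (A x) y = ip x (A y)) /\ (forall x, x != 0 -> 0 < ip (A x) x).

(* Derivative relative to the domain D; at an endpoint of a closed interval it
   is the one-sided derivative. *)
Section derivative_within.
Context {R : realType} {V : normedModType R}.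
Implicit Types (D : set R) (f : R -> V) (t : R).

Definition derivable_within D f t : Prop :=
  cvg ((s - t)^-1 *: (f s - f t) @[s --> within D t^']).

Definition derive_within D f t : V :=
  lim ((s - t)^-1 *: (f s - f t) @[s --> within D t^']).

End derivative_within.

Section gradient.
Context {R : realType} {X : normedModType R}.
Variable ip : X -> X -> R.

Definition gradient (f : X -> R) (x : X) : X :=
  xget 0 [set g | forall v, 'd f x v = ip g v].

Definition hessian (f : X -> R) (x : X) : X -> X := 'd (gradient f) x.

End gradient.

Section assumptions.
Context {R : realType} {X : normedModType R}.
Variables (ip : X -> X -> R) (T : R) (F : R -> X -> R).

Definition dtF (t : R) (x : X) : R := derive_within `[0, T] (F ^~ x) t.

Definition gradF (t : R) (x : X) : X := gradient ip (F t) x.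

Definition hessF (t : R) (x : X) : X -> X := hessian ip (F t) x.

Definition cylinder : set (R * X) := `[0, T] `*` setT.

Definition crit (t : R) : set X := [set x | gradF t x = 0].

Definition F0 : Prop :=
  [/\ forall (t : R) (x : X), t \in `[0, T] ->
        derivable_within `[0, T] (F ^~ x) t,
      forall (t : R) (x : X), t \in `[0, T] -> differentiable (F t) x,
      {within cylinder, continuous (fun p => F p.1 p.2)},
      {within cylinder, continuous (fun p => dtF p.1 p.2)} &
      {within cylinder, continuous (fun p => gradF p.1 p.2)}].

Definition F1 : Prop := forall rho : R, 0 < rho ->
  bounded_set [set x | sup [set `|F t x| | t in `[0, T]] <= rho].

Definition F2 : Prop := exists C1 C2 : R, [/\ 0 < C1, 0 < C2 &
  forall (t : R) (x : X), t \in `[0, T] -> `|dtF t x| <= C1 * F t x + C2].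

Definition F3' : Prop := forall x0 : X, exists L : R,
  \forall x \near x0, L.-lipschitz_`[0, T] (fun t => gradF t x).

(* The last clause is continuity of the Hessian in operator norm. *)
Definition F4 : Prop :=
  (forall (t : R) (x : X), t \in `[0, T] -> differentiable (gradF t) x) /\
  (forall p, cylinder p -> forall e : R, 0 < e ->
    \forall q \near within cylinder (nbhs p),
      forall v, `|hessF q.1 q.2 v - hessF p.1 p.2 v| <= e * `|v|).

Definition F5 : Prop := forall t : R, t \in `[0, T] ->
  crit t `<=` isolated (crit t).

Definition F6 : Prop := forall (t : R) (x : X), t \in `[0, T] -> crit t x ->
  (0 <= limf_einf (fun y => ((F t y - F t x) / `|gradF t y|)%:E) x^')%E.

End assumptions.

Definition second_order_solution (R : realType) (X : normedModType R)
    (ip : X -> X -> R) (T : R) (F : R -> X -> R) (A B : X -> X) (eps : R)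
    (v : R -> X) : Prop :=
  let dv := derive_within `[0, T] v in
  let ddv := derive_within `[0, T] dv in
  forall t : R, t \in `[0, T] ->
    [/\ derivable_within `[0, T] v t, derivable_within `[0, T] dv t &
        eps ^+ 2 *: A (ddv t) + eps *: B (dv t) + gradF ip F t (v t) = 0].

(* Functions on [0, T] are represented by total functions on R, whose values
   outside [0, T] are irrelevant. *)
Section regulated.
Context {R : realType} {X : normedModType R}.
Variables (T : R) (u : R -> X).

Definition regulated : Prop :=
  (forall t : R, 0 <= t < T -> cvg (u s @[s --> t^'+])) /\
  (forall t : R, 0 < t <= T -> cvg (u s @[s --> t^'-])).

Definition uplus (t : R) : X := if t < T then lim (u s @[s --> t^'+]) else u t.

Definition uminus (t : R) : X := if 0 < t then lim (u s @[s --> t^'-]) else u t.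

Definition jump_set : set R := [set t | t \in `[0, T] /\ uminus t <> uplus t].

End regulated.

Section atomic.
Context {R : realType}.
Variable mu : {measure set (measurableTypeR R) -> \bar R}.

Definition atoms : set R := [set t | (0 < mu [set t])%E].

Definition atomic : Prop := mu.-negligible (~` atoms).

End atomic.

(* Main.v *)
Require Import Defs.
From HB Require Import structures.
From mathcomp Require Import all_boot all_order all_algebra.
From mathcomp Require Import all_classical all_reals all_analysis.
From mathcomp Require Import ring lra.

Set Implicit Arguments.
Unset Strict Implicit.
Unset Printing Implicit Defensive.

Import Order.TTheory GRing.Theory Num.Theory.
Import numFieldNormedType.Exports.

Local Open Scope classical_set_scope.
Local Open Scope ring_scope.

(** With [w = eps u'] the energy [E = F(t, u) + <A w, w> / 2] satisfies
    [E' = dtF(t, u) - <B w, w> / eps], so [E] minus a primitive of [dtF(t, u)]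
    decreases, and Gronwall's inequality with (F2) and (F1) bounds [u] and [w].
    - Averaging [E] over a short interval ending at [t] makes the kinetic part
      disappear in the limit, hence [limsup E(t) <= F(t, u_-(t))]; with
      [E >= F(t, u)] this shows that [G = F(t, u) - int_0^t dtF(r, u)] decreases.
    - Integrating the equation shows that [u_+(t)] and [u_-(t)] are critical.
    - If the energy dissipated on an interval of length at least [eps] is small,
      then [u] moves little on every window of length [eps], which also contains
      two well separated times where [w] is small; integrating the equation
      between them shows that the gradient is small along the interval.
      A trajectory leaving an isolated critical point crosses a small sphere on
      which the gradient is bounded below, so a jump dissipates a fixed amount.
    - For [s > t] close to [t], [u_+(s)] is critical at time [s], so (F3') gives
      [|grad F(t, u_+(s))| <= L (s - t)] and (F6) shows that the right derivative
      of [G] vanishes everywhere.  Real induction then identifies the decrease of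
      [G] with the sum of its jumps. *)

(** * Euclidean spaces *)

(** The dissipation controls only the mean of [eps * |u'|^2]. This gives no bound on the variation
    of [u], and inside a fast transition the kinetic energy may stay of order one, so [E] has no
    pointwise limit. The averaging goes backwards from [t] because [E] minus the primitive
    decreases: its value at [t] is then bounded by the preceding mean. Hence [F] enters at the later
    time through its value at [u(t)] and at the earlier time through its value at [u_-];
    monotonicity needs no more. Monotonicity alone leaves two gaps. [G] could decrease like a Cantor
    function, and a vanishing derivative almost everywhere would not prevent this; a vanishing right
    derivative at every point does. Conversely, monotonicity does not make [G] drop where [u] jumps,
    since [F] could take equal values at [u_-] and [u_+]; this is where isolated critical points
    enter. At [t = 0] the value [u_-(0) = u(0)] need not be critical, so a jump there is studied
    around [u_+(0)]. *)

Lemma compact_lower_bound {R : realType} {Y : topologicalType} (K : set Y)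
    (f : Y -> R) : compact K -> continuous f -> (forall x, K x -> 0 < f x) ->
  exists2 d : R, 0 < d & forall x, K x -> d <= f x.
Proof.
move=> /compact_near_coveringP cK cf fpos.
have /cK : forall x, K x -> \forall x' \near x & i \near (0 : R)^'+, i <= f x'.
  move=> x Kx.
  exists ([set x' | f x / 2 < f x'], [set i | i < f x / 2]) => /=.
    split; last by apply: nbhs_right_lt; rewrite divr_gt0// fpos.
    apply: (cvgr_gt (f x)); first exact: cf.
    by rewrite ltr_pdivrMr// ltr_pMr ?fpos// ltr1n.
  by case=> a i [/= h1 h2]; apply: ltW; exact: lt_trans h2 h1.
move=> h; near (0 : R)^'+ => d.
exists d; first by near: d; exact: nbhs_right_gt.
by near: d; exact: h.
Unshelve. all: by end_near. Qed.

Lemma compact_upper_bound {R : realType} {Y : topologicalType} (K : set Y)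
    (f : Y -> R) : compact K -> continuous f ->
  exists2 M : R, 0 < M & forall x, K x -> `|f x| <= M.
Proof.
move=> cK cf.
have : compact (f @` K) by apply: continuous_compact => //; exact: continuous_subspaceT.
move=> /compact_bounded[M [_ hM]].
exists (`|M| + 1); first by rewrite ltr_wpDl.
move=> x Kx; apply: (hM (`|M| + 1)); last by exists x.
by rewrite (le_lt_trans (ler_norm _))// ltrDl.
Qed.

Lemma rV_lincomb_continuous {R : realType} {X : normedModType R} {n : nat}
    (b : 'I_n -> X) :
  continuous (fun c : 'rV[R]_n => \sum_(i < n) c ord0 i *: b i).
Proof.
move=> c; apply: cvg_big; [exact: add_continuous|exact: nbhs_filter|].
move=> i _; apply: cvgZr_tmp; first exact: nbhs_filter.
exact: (differentiable_continuous (differentiable_coord c ord0 i)).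
Qed.

Section euclidean_space.
Context {R : realType} {X : normedModType R} {ip : X -> X -> R} {n : nat}.
Hypothesis hX : euclidean ip n.

Lemma ipC x y : ip x y = ip y x. Proof. exact: euclidean_sym hX _ _. Qed.

Lemma ip0l y : ip 0 y = 0.
Proof.
have := euclidean_linear hX 1 0 0 y; rewrite scaler0 addr0 mul1r => /eqP.
by rewrite -subr_eq0 opprD addNKr oppr_eq0 => /eqP.
Qed.

Lemma ipDl x y z : ip (x + y) z = ip x z + ip y z.
Proof. by have := euclidean_linear hX 1 x y z; rewrite scale1r mul1r. Qed.

Lemma ipZl a x z : ip (a *: x) z = a * ip x z.
Proof. by have := euclidean_linear hX a x 0 z; rewrite addr0 ip0l addr0. Qed.

Lemma ipNl x z : ip (- x) z = - ip x z.
Proof. by rewrite -scaleN1r ipZl mulN1r. Qed.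

Lemma ipBl x y z : ip (x - y) z = ip x z - ip y z.
Proof. by rewrite ipDl ipNl. Qed.

Lemma ipZr a x z : ip z (a *: x) = a * ip z x.
Proof. by rewrite !(ipC z) ipZl. Qed.

Lemma ipBr x y z : ip z (x - y) = ip z x - ip z y.
Proof. by rewrite !(ipC z) ipBl. Qed.

Lemma ip_norm x : ip x x = `|x| ^+ 2.
Proof.
rewrite (euclidean_norm hX); case: (leP 0 (ip x x)) => [/sqr_sqrtr //|h].
have : `|x| = 0 by rewrite (euclidean_norm hX); apply: ler0_sqrtr; exact: ltW.
by move=> /normr0_eq0 x0; move: h; rewrite x0 ip0l ltxx.
Qed.

Lemma ip_le x y : ip x y <= `|x| * `|y|.
Proof.
have [->|x0] := eqVneq x 0; first by rewrite ip0l normr0 mul0r.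
have [->|y0] := eqVneq y 0; first by rewrite ipC ip0l normr0 mulr0.
have : 0 < `|x| * `|y| by rewrite mulr_gt0// normr_gt0.
have := sqr_ge0 (`| `|y| *: x - `|x| *: y |).
rewrite -ip_norm ipBl !ipBr !ipZl !ipZr !ip_norm (ipC y x).
move: (ip x y) `|x| `|y| => p a b; nra.
Qed.

Lemma ip_normr x y : `|ip x y| <= `|x| * `|y|.
Proof.
rewrite ler_norml ip_le andbT lerNl -ipNl.
by rewrite (le_trans (ip_le _ _))// normrN.
Qed.

Lemma cvg_ip (I : Type) (F : set_system I) (FF : Filter F) (f g : I -> X) x y :
  f @ F --> x -> g @ F --> y -> ip (f i) (g i) @[i --> F] --> ip x y.
Proof.
move=> fx gy.
have h1 : ip (f i - x) (g i) @[i --> F] --> 0.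
  apply/norm_cvg0P; apply: (@squeeze_cvgr _ _ _ _ (cst 0) (fun i => `|f i - x| * `|g i|)).
  - by apply: nearW => i; rewrite normr_ge0 ip_normr.
  - exact: cvg_cst.
  - rewrite -[0](mul0r `|y|); apply: cvgM; last exact: cvg_norm.
    rewrite -[X in _ --> X](@normr0 _ X); apply: cvg_norm.
    by rewrite -(subrr x); apply: cvgB => //; exact: cvg_cst.
have h2 : ip x (g i - y) @[i --> F] --> 0.
  apply/norm_cvg0P; apply: (@squeeze_cvgr _ _ _ _ (cst 0) (fun i => `|x| * `|g i - y|)).
  - by apply: nearW => i; rewrite normr_ge0 ip_normr.
  - exact: cvg_cst.
  - rewrite -[0](mulr0 `|x|); apply: cvgM; first exact: cvg_cst.
    rewrite -[X in _ --> X](@normr0 _ X); apply: cvg_norm.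
    by rewrite -(subrr y); apply: cvgB => //; exact: cvg_cst.
rewrite -[ip x y]add0r -[0 in X in _ --> X]addr0.
rewrite (_ : (fun i => ip (f i) (g i)) =
  (fun i => ip (f i - x) (g i) + ip x (g i - y) + ip x y)); last first.
  by apply/funext => i; rewrite ipBl ipBr; ring.
by apply: cvgD; [exact: cvgD|exact: cvg_cst].
Qed.

(** Uniqueness of coordinates makes the coordinate map injective, so its norm has a positive minimum
    on the unit sphere of ['rV[R]_n], which homogeneity extends to every [c]. Compactness of balls,
    boundedness of linear maps and the Riesz representation in [X] all come from this inequality. *)
Lemma euclidean_coord : exists (b : 'I_n -> X) (m : R), [/\ 0 < m,
  forall x, exists c : 'rV[R]_n, x = \sum_(i < n) c ord0 i *: b i &
  forall c : 'rV[R]_n, m * `|c| <= `|\sum_(i < n) c ord0 i *: b i|].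
Proof.
have [b hb] := euclidean_dim hX.
pose phi (c : 'rV[R]_n) := \sum_(i < n) c ord0 i *: b i.
have cphi : continuous phi by exact: rV_lincomb_continuous.
have phi0 : phi 0 = 0 by rewrite /phi big1// => i _; rewrite mxE scale0r.
have phiZ a c : phi (a *: c) = a *: phi c.
  by rewrite /phi scaler_sumr; apply: eq_bigr => i _; rewrite mxE scalerA.
have phi_inj c : phi c = 0 -> c = 0.
  move=> h; have [c' [_ hc']] := hb 0.
  by rewrite -(hc' c)// -(hc' 0)// phi0.
have [m m0 hm] : exists2 m : R, 0 < m &
    forall c : 'rV[R]_n, `|c| = 1 -> m <= `|phi c|.
  apply: compact_lower_bound.
  - apply: bounded_closed_compact.
      by exists 1; split=> // y y1 c /= ->; exact: ltW.
    apply: (@preimage_closed _ _ (fun c : 'rV[R]_n => `|c|) [set 1]) => //.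
      by move=> c _; exact: norm_continuous.
  - move=> c; apply: (continuous_comp (cphi c)); exact: norm_continuous.
  - move=> c c1; rewrite normr_gt0; apply/eqP => /phi_inj c0.
    by move: c1; rewrite c0 normr0 => /esym/eqP; rewrite oner_eq0.
exists b, m; split => //.
  by move=> x; have [c [hc _]] := hb x; exists c.
move=> c; rewrite -/(phi c); have [->|c0] := eqVneq c 0.
  by rewrite phi0 !normr0 mulr0.
have := hm (`|c|^-1 *: c).
have nc : `|c| != 0 by rewrite normr_eq0.
rewrite phiZ !normrZ normfV normr_id mulVf// => /(_ erefl).
by rewrite mulrC ler_pdivlMr// normr_gt0.
Qed.

Lemma closed_ball_compact (r : R) : compact [set x : X | `|x| <= r].
Proof.
have [b [m [m0 hb hm]]] := euclidean_coord.
pose phi (c : 'rV[R]_n) := \sum_(i < n) c ord0 i *: b i.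
have cphi : continuous phi by exact: rV_lincomb_continuous.
have -> : [set x : X | `|x| <= r] = phi @` [set c | `|phi c| <= r].
  apply/seteqP; split=> x /=; last by move=> [c h <-].
  by move=> xr; have [c hc] := hb x; exists c; rewrite /phi -?hc.
apply: continuous_compact; first exact: continuous_subspaceT.
apply: bounded_closed_compact.
  exists (r / m); split; first exact: num_real.
  move=> y ry c /= cr; apply: le_trans (ltW ry).
  by rewrite ler_pdivlMr// mulrC (le_trans (hm c)).
apply: (@preimage_closed _ _ (fun c => `|phi c|) [set y | y <= r]).
  move=> c _; apply: (continuous_comp (cphi c)); exact: norm_continuous.
exact: closed_le.
Qed.

Lemma euclidean_linear_bounded (A : {linear X -> X}) :
  exists2 a : R, 0 < a & forall x, `|A x| <= a * `|x|.
Proof.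
have [b [m [m0 hb hm]]] := euclidean_coord.
pose S := \sum_(i < n) `|A (b i)|.
have S0 : 0 <= S by apply: sumr_ge0.
exists (S / m + 1); first by rewrite ltr_wpDl// divr_ge0// ltW.
move=> x; have [c ->] := hb x.
rewrite linear_sum (@le_trans _ _ (S / m * `|\sum_(i < n) c ord0 i *: b i|))//; last first.
  by rewrite ler_wpM2r// lerDl.
apply: (@le_trans _ _ (S * `|c|)).
  rewrite mulr_suml (le_trans (ler_norm_sum _ _ _))// ler_sum// => i _.
  rewrite linearZ normrZ mulrC ler_wpM2l//.
  rewrite [leRHS]/Num.Def.normr /= mx_normrE; apply/bigmax_geP; right => /=.
  by exists (ord0, i).
rewrite -mulrA ler_wpM2l// mulrC ler_pdivlMr// mulrC; exact: hm.
Qed.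

Lemma euclidean_linear_continuous (A : {linear X -> X}) : continuous A.
Proof.
have [a a0 ha] := euclidean_linear_bounded A.
move=> x; apply/cvgrPdist_lt => e e0; near=> y.
rewrite -linearB (le_lt_trans (ha _))// mulrC -ltr_pdivlMr//.
by near: y; apply: cvgr_dist_lt; [exact: cvg_id|rewrite divr_gt0].
Unshelve. all: by end_near. Qed.

Lemma sym_posdef_coercive (B : {linear X -> X}) : sym_posdef ip B ->
  exists2 c : R, 0 < c & forall x, c * `|x| ^+ 2 <= ip (B x) x.
Proof.
move=> [_ hB].
have [c c0 hc] : exists2 c : R, 0 < c & forall x, `|x| = 1 -> c <= ip (B x) x.
  apply: compact_lower_bound.
  - apply: (subclosed_compact _ (@closed_ball_compact 1)).
      apply: (@preimage_closed _ _ (fun c : X => `|c|) [set 1]) => //.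
      by move=> c _; exact: norm_continuous.
    by move=> x /= ->.
  - by move=> x; apply: cvg_ip; [exact: euclidean_linear_continuous|exact: cvg_id].
  - by move=> x x1; apply: hB; rewrite -normr_eq0 x1 oner_eq0.
exists c => // x; have [->|x0] := eqVneq x 0.
  by rewrite normr0 expr0n mulr0 linear0 ip0l.
have nx : 0 < `|x| by rewrite normr_gt0.
have := hc (`|x|^-1 *: x).
rewrite linearZ ipZl ipZr normrZ normfV normr_id mulVf ?gt_eqF// => /(_ erefl) h.
have -> : ip (B x) x = `|x| ^+ 2 * (`|x|^-1 * (`|x|^-1 * ip (B x) x)).
  by field; rewrite gt_eqF.
by rewrite mulrC ler_wpM2l// exprn_ge0.
Qed.

Lemma riesz (l : {linear X -> R}) : exists g, forall v, l v = ip g v.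
Proof.
have [b [m [m0 hb hm]]] := euclidean_coord.
pose phi (c : 'rV[R]_n) := \sum_(i < n) c ord0 i *: b i.
have ipphi c y : ip (phi c) y = \sum_(i < n) c ord0 i * ip (b i) y.
  rewrite /phi; elim/big_rec2: _ => [|i u v _ <-]; first exact: ip0l.
  by rewrite ipDl ipZl.
pose G : 'M[R]_n := \matrix_(i, j) ip (b i) (b j).
have GE (c : 'rV[R]_n) j : (c *m G) ord0 j = ip (phi c) (b j).
  by rewrite mxE ipphi; apply: eq_bigr => i _; rewrite mxE.
have Gfree : row_free G.
  apply/row_freeP; exists (invmx G); apply: mulmxV.
  rewrite -row_free_unit -kermx_eq0; apply/eqP/row_matrixP => i.
  rewrite row0; set c := row i _.
  have cG : c *m G = 0 by apply/sub_kermxP; exact: row_sub.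
  have : ip (phi c) (phi c) = 0.
    rewrite ipphi big1// => j _.
    by rewrite ipC -GE cG [X in _ * X]mxE mulr0.
  rewrite ip_norm => /eqP; rewrite sqrf_eq0 => /eqP p0.
  have := hm c; rewrite -/(phi c) p0 pmulr_rle0// normr_le0 => /eqP; exact.
pose c := (\row_j l (b j)) *m invmx G.
exists (phi c) => v; have [d ->] := hb v.
rewrite linear_sum -/(phi d) ipC ipphi; apply: eq_bigr => j _.
rewrite linearZ ipC -GE mulmxKV ?mxE//.
by rewrite -row_free_unit.
Qed.

Lemma gradientP (f : X -> R) x v : 'd f x v = ip (gradient ip f x) v.
Proof.
have [g hg] := riesz ('d f x).
by have /(_ v) := @xgetPex _ 0 [set g | forall v, 'd f x v = ip g v]
  (ex_intro _ g hg).
Qed.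

End euclidean_space.

(** * Derivatives, clamped time and real induction *)

Lemma dnbhs_shift0 {R : realType} {Y : Type} (f : R -> Y) (t : R) :
  (f \o shift t) h @[h --> 0^'] = f s @[s --> t^'].
Proof.
apply/funext => P; apply/propext.
change ((\forall h \near (0 : R), h != 0 -> P (f (h + t))) <->
        (\forall x \near t, x != t -> P (f x))).
rewrite (near_shift 0 t) subr0.
split; apply: filterS => h /= H hn; apply: H.
  by rewrite -subr_eq0 addrK in hn.
by rewrite -subr_eq0 addrK.
Qed.

Lemma is_derive1_quotP {R : realType} {V : normedModType R} (f : R -> V)
    (t : R) (l : V) :
  is_derive t 1 f l <-> (s - t)^-1 *: (f s - f t) @[s --> t^'] --> l.
Proof.
have E : h^-1 *: ((f \o shift t) (h *: 1) - f t) @[h --> 0^'] =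
         (s - t)^-1 *: (f s - f t) @[s --> t^'].
  rewrite -[RHS]dnbhs_shift0; apply: (congr1 (fun F => F h @[h --> 0^'])).
  apply/funext => h /=.
  by rewrite addrK /GRing.scale /= mulr1.
split=> [[]|h].
- by rewrite /derivable /derive E => h1 h2; rewrite -h2.
- split; first by rewrite /derivable E; apply/cvg_ex; exists l.
  by rewrite /derive E; apply: cvg_lim.
Qed.

Lemma is_derive_within {R : realType} {V : normedModType R} (T t : R)
    (f : R -> V) : 0 < t < T -> derivable_within `[0, T]%classic f t ->
  is_derive t 1 f (derive_within `[0, T]%classic f t).
Proof.
move=> tT df; apply/is_derive1_quotP.
suff E : within `[0, T]%classic t^' = t^'.
  by move: df; rewrite /derivable_within /derive_within E.
case/andP: tT => t0 tT; apply/seteqP; split=> P; last exact: cvg_within.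
rewrite /within /= => h.
have h2 : \forall s \near t^', `[0, T]%classic s.
  apply: nbhs_dnbhs; near=> s; rewrite /= in_itv /=; apply/andP; split; apply: ltW.
    by near: s; exact: lt_nbhsr.
  by near: s; exact: lt_nbhsl.
by apply: filterS2 h h2 => s; apply.
Unshelve. all: by end_near. Qed.

Lemma derivable_within_cvg {R : realType} {V : normedModType R} (D : set R)
    (f : R -> V) (t : R) : D t -> derivable_within D f t ->
  f s @[s --> within D (nbhs t)] --> f t.
Proof.
move=> Dt; rewrite /derivable_within => /cvg_ex[l hl].
have h1 : f s @[s --> within D t^'] --> f t.
  have : (s - t) *: ((s - t)^-1 *: (f s - f t)) + f t @[s --> within D t^']
    --> (t - t) *: l + f t.
    apply: cvgD; last exact: cvg_cst.
    apply: cvgZ hl; apply: cvgB; last exact: cvg_cst.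
    by apply: cvg_within_filter; exact: nbhs_dnbhs.
  rewrite subrr scale0r add0r; apply: cvg_trans; apply: near_eq_cvg.
  have : \forall s \near within D t^', s != t.
    have h0 : t^' [set s | s != t] by exact: withinT.
    by move: h0; apply: cvg_within.
  apply: filterS => s st; rewrite -subr_eq0 in st.
  by rewrite scalerA divff// scale1r subrK.
move=> P Pt; have := h1 P Pt.
change ((\forall s \near t, s != t -> D s -> P (f s)) ->
  (\forall s \near t, D s -> P (f s))); apply: filterS.
move=> s h Ds; have [->|st] := eqVneq s t; first exact: nbhs_singleton.
exact: h.
Unshelve. all: by end_near. Qed.

Lemma continuous_within_comp {Y Z W : topologicalType} (D : set Y) (f : Y -> Z)
    (c : W -> Y) : {within D, continuous f} -> continuous c ->
  (forall w, D (c w)) -> continuous (f \o c).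
Proof.
move=> /subspace_continuousP cf cc Dc w P /(cf _ (Dc w)).
rewrite /within /fmap /mkset /= => /cc.
change ((\forall w' \near w, D (c w') -> P (f (c w'))) ->
  \forall w' \near w, P (f (c w'))).
by apply: filterS => w' h; exact/h/Dc.
Qed.

(* Composing with [clamp T] turns continuity relative to [`[0, T]] or to the
   cylinder into continuity everywhere, without changing anything on [`[0, T]]. *)
Definition clamp {R : realType} (T t : R) : R := Num.max 0 (Num.min t T).

Lemma clamp_in {R : realType} (T t : R) : 0 <= T -> clamp T t \in `[0, T].
Proof.
by move=> T0; rewrite in_itv /= /clamp le_max lexx /= ge_max T0 ge_min lexx orbT.
Qed.

Lemma clampE {R : realType} (T t : R) : 0 <= t <= T -> clamp T t = t.
Proof.
by case/andP => t0 tT; rewrite /clamp; move/min_idPl : tT => ->; exact/max_idPr.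
Qed.

Lemma clamp_continuous {R : realType} (T : R) : continuous (clamp T).
Proof.
move=> t; apply/cvgrPdist_lt => e e0; near=> s.
apply: (@le_lt_trans _ _ `|t - s|); last first.
  by near: s; apply: cvgr_dist_lt; [exact: cvg_id|].
have h1 := ler_norm (t - s); have h2 := ler_norm (s - t); rewrite distrC in h2.
rewrite /clamp ler_norml; move: h1 h2; move: `|t - s| => d h1 h2.
have [h3|h3] := leP t T; have [h4|h4] := leP s T.
- have [h5|h5] := leP 0 t; have [h6|h6] := leP 0 s; lra.
- have [h5|h5] := leP 0 t; have [h6|h6] := leP 0 T; lra.
- have [h5|h5] := leP 0 T; have [h6|h6] := leP 0 s; lra.
- have [h5|h5] := leP 0 T; lra.
Unshelve. all: by end_near. Qed.

(** * Mean value inequalities and the chain rule *)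

Lemma is_derive_near_eq {R : realType} {V : normedModType R} (f g : R -> V)
    (t : R) (l : V) : (\forall s \near t, f s = g s) ->
  is_derive t 1 f l -> is_derive t 1 g l.
Proof.
move=> fg /is_derive1_quotP h; apply/is_derive1_quotP.
apply: cvg_trans h; apply: near_eq_cvg.
have ft := nbhs_singleton fg.
by apply: nbhs_dnbhs; apply: filterS fg => s ->; rewrite ft.
Qed.

Lemma clamp_near {R : realType} (T t : R) : 0 < t < T ->
  \forall s \near t, clamp T s = s.
Proof.
case/andP => t0 tT; near=> s; apply: clampE; apply/andP; split; apply: ltW.
  by near: s; exact: lt_nbhsr.
by near: s; exact: lt_nbhsl.
Unshelve. all: by end_near. Qed.

Lemma is_derive_continuous {R : realType} {V : normedModType R} (f : R -> V)
    (t : R) (l : V) : is_derive t 1 f l -> {for t, continuous f}.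
Proof. by move=> [h _]; apply: differentiable_continuous; exact/derivable1_diffP. Qed.

Lemma derive_increment_le {R : realType} (f df : R -> R) (a b c : R) : a <= b ->
  continuous f -> (forall x, a < x < b -> is_derive x 1 f (df x)) ->
  (forall x, a < x < b -> df x <= c) -> f b - f a <= c * (b - a).
Proof.
rewrite le_eqVlt => /orP[/eqP<- _ _ _|ab cf hf hc]; first by rewrite !subrr mulr0.
have df_itv x : x \in `]a, b[ -> is_derive x 1 f (df x).
  by rewrite in_itv /=; exact: hf.
have [x xab ->] := MVT ab df_itv (continuous_subspaceT cf).
rewrite ler_wpM2r ?subr_ge0//; first exact: ltW.
by apply: hc; move: xab; rewrite in_itv.
Qed.

Lemma derive_increment {R : realType} (f df : R -> R) (a b : R) : a < b ->
  continuous f -> (forall x, a < x < b -> is_derive x 1 f (df x)) ->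
  exists2 c, a < c < b & f b - f a = df c * (b - a).
Proof.
move=> ab cf hf.
have df_itv x : x \in `]a, b[ -> is_derive x 1 f (df x).
  by rewrite in_itv /=; exact: hf.
have [x xab ->] := MVT ab df_itv (continuous_subspaceT cf).
by exists x => //; move: xab; rewrite in_itv.
Qed.

(** Let [m] be the supremum of the points up to which [P] holds without gap: the left clause gives
    [P m], and the right clause would pass beyond [m] if [m < b]. *)
Lemma real_induction {R : realType} (a b : R) (P : R -> Prop) : a <= b -> P a ->
  (forall t, a <= t < b -> P t ->
    exists2 d, 0 < d & forall r, t < r < t + d -> r < b -> P r) ->
  (forall t, a < t <= b -> (forall r, a <= r < t -> P r) -> P t) ->
  P b.
Proof.
move=> ab Pa Pright Pleft.
pose S := [set t | a <= t <= b /\ forall r, a <= r <= t -> P r].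
have Sa : S a.
  split; first by rewrite lexx ab.
  by move=> r /le_anti <-.
have Sub : ubound S b by move=> t [/andP[]].
have hS : has_sup S by split; [exists a|exists b].
pose m := sup S.
have am : a <= m by apply: ub_le_sup => //; exact: hS.2.
have mb : m <= b by apply: ge_sup => //; exists a.
have Plt r : a <= r < m -> P r.
  case/andP => ar rm; have [t [_ St] rt] := sup_gt hS.1 rm.
  by apply: St; rewrite ar ltW.
have Pm : P m.
  move: am; rewrite le_eqVlt => /orP[/eqP <-//|am].
  by apply: Pleft => //; rewrite am.
move: mb; rewrite le_eqVlt => /orP[/eqP <-//|mb].
have [d d0 hd] := Pright m (introT andP (conj am mb)) Pm.
pose r := Num.min (m + d / 2) ((m + b) / 2).
have mr : m < r by rewrite /r lt_min; lra.
have rd : r < m + d by rewrite /r gt_min; lra.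
have rb : r < b by rewrite /r gt_min; apply/orP; right; lra.
have : S r.
  split; first by lra.
  move=> x /andP[ax xr]; have [xm|mx] := ltP x m; first by apply: Plt; rewrite ax.
  move: mx; rewrite le_eqVlt => /orP[/eqP <-//|mx]; apply: hd; lra.
by move=> /(ub_le_sup hS.2); rewrite leNgt mr.
Qed.

Lemma continuous2_dist {R : realType} {X Z : normedModType R} (h : R -> X -> Z) :
  continuous (fun p : R * X => h p.1 p.2) -> forall t x (e : R), 0 < e ->
  exists2 d : R, 0 < d & forall s y, `|s - t| < d -> `|y - x| < d ->
    `|h s y - h t x| < e.
Proof.
move=> ch t x e e0; have /cvgrPdist_lt/(_ e e0) := ch (t, x).
move=> [[A1 A2] /= [/nbhs_ballP[d1 d10 h1] /nbhs_ballP[d2 d20 h2]] h12].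
exists (Num.min d1 d2); first by rewrite lt_min d10.
move=> s y; rewrite !lt_min => /andP[s1 _] /andP[_ y2]; rewrite distrC.
by apply: (h12 (s, y)); split => /=; [apply: h1|apply: h2]; rewrite -ball_normE /= distrC.
Qed.

Lemma is_derive1D {R : realType} {V : normedModType R} (f g : R -> V) (t : R) (df dg : V) :
  is_derive t 1 f df -> is_derive t 1 g dg ->
  is_derive t 1 (fun s => f s + g s) (df + dg).
Proof. exact: is_deriveD. Qed.

Lemma is_derive1Z {R : realType} {V : normedModType R} (c : R) (f : R -> V) (t : R) (df : V) :
  is_derive t 1 f df -> is_derive t 1 (fun s => c *: f s) (c *: df).
Proof. exact: is_deriveZ. Qed.

Lemma is_derive1B {R : realType} {V : normedModType R} (f g : R -> V) (t : R) (df dg : V) :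
  is_derive t 1 f df -> is_derive t 1 g dg ->
  is_derive t 1 (fun s => f s - g s) (df - dg).
Proof. exact: is_deriveB. Qed.

(** Joint differentiability of [f] is not assumed, so the increment is split at [f t (v s)]. The
    mean value theorem in time turns the first part into [ft c (v s) * (s - t)] with [c] between [s]
    and [t], and joint continuity of [ft] gives its limit; the second part is the ordinary chain
    rule for [f t]. *)
Lemma is_derive_partial {R : realType} {X : normedModType R} (T : R)
    (f ft : R -> X -> R) (v : R -> X) (t : R) (dv : X) :
  0 < t < T -> (forall x, continuous (f ^~ x)) ->
  (forall s x, 0 < s < T -> is_derive s 1 (f ^~ x) (ft s x)) ->
  continuous (fun p : R * X => ft p.1 p.2) ->
  differentiable (f t) (v t) -> is_derive t 1 v dv ->
  is_derive t 1 (fun s => f s (v s)) (ft t (v t) + 'd (f t) (v t) dv).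
Proof.
move=> tT cf hft cft df hv.
have h2 : is_derive t 1 (f t \o v) ('d (f t) (v t) dv).
  have dv' : differentiable v t by apply/derivable1_diffP; case: hv.
  have dfv : differentiable (f t \o v) t by exact: differentiable_comp.
  split; first exact/derivable1_diffP.
  have <- : 'd v t 1 = dv by rewrite -deriveE//; case: hv.
  by rewrite deriveE// diff_comp.
move/is_derive1_quotP : h2 => h2; apply/is_derive1_quotP.
have h1 : (s - t)^-1 * (f s (v s) - f t (v s)) @[s --> t^'] --> ft t (v t).
  apply/cvgrPdist_lt => e e0.
  have [d d0 hd] := continuous2_dist cft t (v t) e0.
  have cv := is_derive_continuous hv.
  have nv : \forall s \near t, `|v t - v s| < d by apply: cvgr_dist_lt cv _ d0.
  have nt : \forall s \near t, `|t - s| < d.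
    by apply/nbhs_ballP; exists d => //= s; rewrite -ball_normE.
  have n0 : \forall s \near t, 0 < s by case/andP: tT => t0 _; exact: lt_nbhsr.
  have nT : \forall s \near t, s < T by case/andP: tT => _ t0; exact: lt_nbhsl.
  have st : t^' [set s | s != t] by exact: withinT.
  have N : \forall s \near t^', [/\ `|v t - v s| < d, `|t - s| < d, 0 < s & s < T].
    by apply: nbhs_dnbhs; near=> s; split; near: s.
  apply: filterS2 N st => s [vd td s0 sT] /= ns.
  suff [c cd ->] : exists2 c, `|c - t| < d &
      f s (v s) - f t (v s) = ft c (v s) * (s - t).
    rewrite mulrC mulfK ?subr_eq0// distrC; apply: hd => //.
    by rewrite distrC.
  move: tT td => /andP[t0 tT].
  have [st'|st'|E] := ltgtP s t; last by rewrite E eqxx in ns.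
  - rewrite gtr0_norm ?subr_gt0// => td.
    have [c /andP[c1 c2] E] := 
      @derive_increment _ (f ^~ (v s)) (ft ^~ (v s)) _ _ st' (cf _)
      (fun x hx => hft _ _ (introT andP
        (conj (lt_trans s0 (andP hx).1) (lt_trans (andP hx).2 tT)))).
    exists c; first by rewrite ltr0_norm; lra.
    by move: E; move: (f t _) (f s _) (ft c _) => x y z E; lra.
  - rewrite ltr0_norm ?subr_lt0// => td.
    have [c /andP[c1 c2] E] := 
      @derive_increment _ (f ^~ (v s)) (ft ^~ (v s)) _ _ st' (cf _)
      (fun x hx => hft _ _ (introT andP
        (conj (lt_trans t0 (andP hx).1) (lt_trans (andP hx).2 sT)))).
    by exists c => //; rewrite gtr0_norm; lra.
rewrite (_ : (fun s => (s - t)^-1 *: (f s (v s) - f t (v t))) =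
  (fun s => (s - t)^-1 * (f s (v s) - f t (v s)) +
    (s - t)^-1 *: ((f t \o v) s - (f t \o v) t))); first exact: cvgD.
by apply/funext => s /=; rewrite /GRing.scale /= -mulrDr; congr (_ * _); lra.
Unshelve. all: by end_near. Qed.

Section euclidean_derive.
Context {R : realType} {X : normedModType R} {ip : X -> X -> R} {n : nat}.
Hypothesis hX : euclidean ip n.

Lemma is_derive_ip (a b : R -> X) (t : R) (da db : X) :
  is_derive t 1 a da -> is_derive t 1 b db ->
  is_derive t 1 (fun s => ip (a s) (b s)) (ip da (b t) + ip (a t) db).
Proof.
move=> ha hb; have cb := is_derive_continuous hb.
move/is_derive1_quotP : ha => ha; move/is_derive1_quotP : hb => hb.
apply/is_derive1_quotP.
rewrite (_ : (fun s => _) = (fun s => ip ((s - t)^-1 *: (a s - a t)) (b s) +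
   ip (a t) ((s - t)^-1 *: (b s - b t)))).
  apply: cvgD; apply: (cvg_ip hX) => //; last exact: cvg_cst.
  by apply: cvg_trans cb; apply: cvg_app; exact: nbhs_dnbhs.
apply/funext => s; rewrite (ipZl hX) (ipZr hX) (ipBl hX) (ipBr hX) /GRing.scale /=.
ring.
Qed.

Lemma is_derive_linear (A : {linear X -> X}) (w : R -> X) (t : R) (dw : X) :
  is_derive t 1 w dw -> is_derive t 1 (fun s => A (w s)) (A dw).
Proof.
move=> /is_derive1_quotP hw; apply/is_derive1_quotP.
rewrite (_ : (fun s => _) = (fun s => A ((s - t)^-1 *: (w s - w t)))).
  exact: (cvg_comp _ _ hw (@euclidean_linear_continuous _ _ _ _ hX A dw)).
apply/funext => s; rewrite -linearB; apply/esym; exact: linearZ_LR.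
Qed.

End euclidean_derive.

Lemma is_derive_clamp {R : realType} (f : R -> R) (T t c l : R) : 0 < t < T ->
  is_derive t 1 f l -> is_derive t 1 (fun s => f (clamp T s) - c) l.
Proof.
move=> tT hf; apply: (@is_derive_near_eq _ _ (fun s => f s - c)).
  by apply: filterS (clamp_near tT) => s ->.
rewrite -[l]subr0; apply: is_derive1B => //; exact: is_derive_cst.
Qed.

(* Dominated convergence, phrased with primitives so that the approximating
   integrals can be handled by the mean value theorem alone. *)
Lemma antiderivative_limit {R : realType} (T K : R) (phi : nat -> R -> R)
    (psi : R -> R) : 0 <= T -> (forall k, continuous (phi k)) ->
  (forall k (t : R), 0 <= t <= T -> `|phi k t| <= K) ->
  (forall (t : R), 0 <= t <= T -> phi k t @[k --> \oo] --> psi t) ->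
  exists (P : nat -> R -> R) (I : R -> R), [/\
    forall k, continuous (P k),
    forall k (t : R), 0 < t < T -> is_derive t 1 (P k) (phi k t),
    forall (t : R), 0 <= t <= T -> P k t @[k --> \oo] --> I t,
    forall (s t : R), 0 <= s -> s <= t -> t <= T ->
      (\int[lebesgue_measure]_(r in `[s, t]%classic) (psi r)%:E = (I t - I s)%:E)%E &
    forall (s t c : R), 0 <= s -> s <= t -> t <= T ->
      ((forall r : R, s < r < t -> psi r <= c) -> I t - I s <= c * (t - s)) /\
      ((forall r : R, s < r < t -> c <= psi r) -> c * (t - s) <= I t - I s)].
Proof.
move=> T0 cphi bphi hpsi.
pose mu := @lebesgue_measure R.
have iphi k (a b : R) : mu.-integrable `[a, b]%classic (EFin \o phi k).
  apply: continuous_compact_integrable; first exact: segment_compact.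
  exact: continuous_subspaceT.
(* Starting at -1 puts all of [[0, T]] in the interior of the domain, so the fundamental theorem of
   calculus also yields continuity at 0. Below, [P] is clamped to be continuous on the whole line
   and normalised to vanish at 0. *)
pose P0 (k : nat) (t : R) := (\int[mu]_(r in `[(- 1), t]) phi k r)%R.
have dP0 k (t : R) : -1 < t -> is_derive t 1 (P0 k) (phi k t).
  move=> t1; have tt1 : t < t + 1 by lra.
  have [h1 h2] := continuous_FTC1_closed tt1 (iphi k (-1) (t + 1)) t1 (cphi k t).
  by split; [exact: h1|rewrite -derive1E; exact: h2].
pose P (k : nat) (t : R) := P0 k (clamp T t) - P0 k 0.
have PE k (t : R) : 0 <= t <= T -> P k t = (\int[mu]_(r in `[0, t]) phi k r)%R.
  move=> tT; rewrite /P clampE// /P0 Rintegral_itvB//=.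
  - rewrite Rintegral_itv_obnd_cbnd//.
    apply: integrableS (iphi k 0 t) => //.
    by apply: subset_itv; rewrite bnd_simp.
  - by rewrite bnd_simp; lra.
  - by rewrite bnd_simp; case/andP: tT.
have mD (s t : R) : measurable `[s, t]%classic by exact: measurable_itv.
have fin (s t : R) : (mu `[s, t]%classic < +oo)%E.
  by rewrite /mu lebesgue_measure_itv/=; case: ifP => // _; rewrite -EFinB ltry.
have sub (s t : R) : 0 <= s -> t <= T -> forall r, `[s, t]%classic r -> 0 <= r <= T.
  by move=> s0 tT r /=; rewrite in_itv /= => /andP[]; lra.
have DCT (s t : R) : 0 <= s -> t <= T -> mu.-integrable `[s, t]%classic (EFin \o psi) /\
    (\int[mu]_(r in `[s, t]) phi k r)%R @[k --> \oo] -->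
    (\int[mu]_(r in `[s, t]) psi r)%R.
  move=> s0 tT.
  have mphi k : measurable_fun `[s, t]%classic (phi k).
    apply: (@measurable_funS _ _ _ _ setT) => //.
    exact: measurable_realfun.continuous_measurable_fun.
  have mpsi : measurable_fun `[s, t]%classic psi.
    by apply: (measurable_realfun.measurable_fun_cvg mphi) => r rst; apply: hpsi; exact: (sub s t).
  have iK : mu.-integrable `[s, t]%classic (EFin \o cst K).
    apply: measurable_bounded_integrable => //; exists `|K|; split => //.
    by move=> y Ky r _ /=; exact: ltW.
  have [] := @dominated_convergence _ _ _ mu _ (mD s t)
    (fun k => EFin \o phi k) (EFin \o psi) (EFin \o cst K).
  - by move=> k; apply/measurable_realfun.measurable_EFinP; exact: mphi.
  - by apply/measurable_realfun.measurable_EFinP; exact: mpsi.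
  - apply: aeW => r rst /=; apply: cvg_EFin; first exact: nearW.
    by apply: hpsi; exact: (sub s t).
  - exact: iK.
  - by apply: aeW => r k rst /=; rewrite lee_fin; apply: bphi; exact: (sub s t).
  move=> ipsi _ hcv; split => //.
  apply: fine_cvg; move: hcv; rewrite /Rintegral fineK//.
  exact: integrable_fin_num.
pose I (t : R) := (\int[mu]_(r in `[0, t]) psi r)%R.
have IE (s t : R) : 0 <= s -> s <= t -> t <= T ->
    I t - I s = (\int[mu]_(r in `[s, t]) psi r)%R.
  move=> s0 st tT; have [ip _] := DCT 0 t (lexx _) tT.
  rewrite /I Rintegral_itvB//= ?bnd_simp//.
  rewrite Rintegral_itv_obnd_cbnd//.
  apply: integrableS (ip) => //.
  by apply: subset_itv; rewrite bnd_simp.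
have cst_int (s t c : R) : s <= t ->
    (\int[mu]_(r in `[s, t]) c)%R = c * (t - s).
  move=> st; transitivity (c * fine (mu `[s, t]%classic)).
    exact: Rintegral_cst.
  rewrite /mu lebesgue_measure_itv /= lte_fin.
  by case: ltP => // ts; rewrite (le_anti (introT andP (conj st ts))) subrr.
have icst (s t c : R) : mu.-integrable `[s, t]%classic (EFin \o cst c).
  apply: measurable_bounded_integrable => //; exists `|c|; split => //.
  by move=> y Ky r _ /=; exact: ltW.
(* Endpoints have measure zero, so bounds on the integrand are asked only on the open interval.
   There [u] is close to its one-sided limit, while its value at the endpoint is arbitrary. *)
have open_closed (s t : R) (f : R -> R) : mu.-integrable `[s, t]%classic (EFin \o f) ->
    mu.-integrable `]s, t[%classic (EFin \o f) /\
    (\int[mu]_(r in `[s, t]) f r)%R = (\int[mu]_(r in `]s, t[) f r)%R.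
  move=> ifst; have io : mu.-integrable `]s, t[%classic (EFin \o f).
    apply: integrableS ifst => //.
    by apply: subset_itv; rewrite bnd_simp.
  split => //; rewrite /Rintegral integral_itv_bndoo//.
  by case/integrableP: io.
exists P, I; split.
- move=> k t; apply: cvgB; last exact: cvg_cst.
  apply: (@continuous_comp _ _ _ (clamp T) (P0 k) t).
    exact: clamp_continuous.
  have ct : -1 < clamp T t by have := clamp_in t T0; rewrite in_itv /= => /andP[]; lra.
  exact: (is_derive_continuous (dP0 k (clamp T t) ct)).
- move=> k t tT; apply: is_derive_clamp => //.
  by apply: dP0; case/andP: tT => t0 _; lra.
- move=> t tT; rewrite (_ : (fun k => P k t) = (fun k => \int[mu]_(r in `[0, t]) phi k r)%R).
    by have [_] := DCT 0 t (lexx _) (andP tT).2.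
  by apply/funext => k; exact: PE.
- move=> s t s0 st tT; rewrite IE// /Rintegral fineK//.
  apply: integrable_fin_num => //; exact: (DCT s t s0 tT).1.
- move=> s t c s0 st tT; rewrite IE// -cst_int//.
  have [ip1 ->] := open_closed _ _ _ (DCT s t s0 tT).1.
  have [ip2 ->] := open_closed _ _ _ (icst s t c).
  split => h; apply: le_Rintegral => // r /=; rewrite in_itv /=; exact: h.
Qed.

(** * A single solution *)

Lemma is_derive_expR_lin {R : realType} (c a x : R) :
  is_derive x 1 (fun s => expR (c * (s - a))) (c * expR (c * (x - a))).
Proof.
have h1 : is_derive x 1 (fun s : R => c * (s - a)) c.
  rewrite -[X in is_derive _ _ _ X]mulr1; apply: is_derive1Z.
  by rewrite -[X in is_derive _ _ _ X]subr0; apply: is_derive1B.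
have h2 := is_derive_expR (c * (x - a)).
by have := is_derive1_comp (g := fun s => c * (s - a)) h2 h1; rewrite mulrC.
Qed.

Lemma continuous_graph {R : realType} {X : normedModType R} (v : R -> X) :
  continuous v -> continuous (fun s => (s, v s)).
Proof.
move=> cv s; apply: (@cvg_pair _ _ _ (nbhs s) (nbhs s) (nbhs (v s))).
  exact: cvg_id.
exact: cv.
Qed.

Lemma continuous_slice {R : realType} {X Z : normedModType R} (h : R -> X -> Z)
    (x : X) : continuous (fun p : R * X => h p.1 p.2) -> continuous (h ^~ x).
Proof.
move=> ch s; apply: (@continuous_comp _ _ _ (fun s => (s, x)) (fun p : R * X => h p.1 p.2)).
  by apply: continuous_graph; exact: cst_continuous.
exact: ch.
Qed.

Lemma is_derive1M {R : realType} (f g : R -> R) (t df dg : R) :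
  is_derive t 1 f df -> is_derive t 1 g dg ->
  is_derive t 1 (fun s => f s * g s) (f t * dg + g t * df).
Proof. exact: is_deriveM. Qed.

(** The weighted function behind both forms of Gronwall's inequality: [d = C2 / C1] makes the affine
    differential inequality homogeneous, with [c = - C1] forwards in time and [c = C1] backwards. *)
Lemma is_derive_exp_weight {R : realType} (h : R -> R) (dh x a c d : R) :
  is_derive x 1 h dh -> is_derive x 1 (fun s => expR (c * (s - a)) * (h s + d))
    (expR (c * (x - a)) * (dh + c * (h x + d))).
Proof.
move=> hx.
have h1 : is_derive x 1 (fun s : R => h s + d) dh.
  by rewrite -[X in is_derive _ _ _ X]addr0; apply: is_derive1D.
apply: is_derive_eq (is_derive1M (is_derive_expR_lin c a x) h1) _; ring.
Qed.

Lemma continuous_exp_weight {R : realType} (h : R -> R) (a c d : R) :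
  continuous h -> continuous (fun s => expR (c * (s - a)) * (h s + d)).
Proof.
move=> ch x; apply: cvgM.
  exact: is_derive_continuous (is_derive_expR_lin c a x).
by apply: cvgD; [exact: ch|exact: cvg_cst].
Qed.

Lemma gronwall {R : realType} (h dh : R -> R) (a b C1 C2 : R) : a <= b ->
  0 < C1 -> continuous h -> (forall x, a < x < b -> is_derive x 1 h (dh x)) ->
  (forall x, a < x < b -> dh x <= C1 * h x + C2) ->
  h b + C2 / C1 <= expR (C1 * (b - a)) * (h a + C2 / C1).
Proof.
move=> ab C10 ch dh' hle.
have H := derive_increment_le ab (@continuous_exp_weight _ h a (- C1) (C2 / C1) ch)
  (fun x hx => is_derive_exp_weight a (- C1) (C2 / C1) (dh' x hx)).
have {}H := H 0 _; rewrite mul0r subrr mulr0 expR0 mul1r in H.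
rewrite -ler_pdivrMl ?expR_gt0// -expRN -mulNr -subr_le0; apply: H => x xab.
rewrite mulr_ge0_le0 ?expR_ge0//.
have := hle x xab; rewrite mulrDr !mulNr mulrCA divff ?gt_eqF// mulr1; lra.
Qed.

Lemma gronwall_rev {R : realType} (h dh : R -> R) (a b C1 C2 : R) : a <= b ->
  0 < C1 -> continuous h -> (forall x, a < x < b -> is_derive x 1 h (dh x)) ->
  (forall x, a < x < b -> - dh x <= C1 * h x + C2) ->
  h a + C2 / C1 <= expR (C1 * (b - a)) * (h b + C2 / C1).
Proof.
move=> ab C10 ch dh' hle.
have [E|ab'] := eqVneq a b; first by rewrite E subrr mulr0 expR0 mul1r.
have {}ab : a < b by rewrite lt_def eq_sym ab'.
have [x xab] := derive_increment ab (@continuous_exp_weight _ h a C1 (C2 / C1) ch)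
  (fun x hx => is_derive_exp_weight a C1 (C2 / C1) (dh' x hx)).
rewrite subrr mulr0 expR0 mul1r => E; rewrite -subr_ge0 E.
rewrite mulr_ge0 ?subr_ge0 ?(ltW ab)// mulr_ge0 ?expR_ge0//.
have := hle x xab; rewrite mulrDr mulrCA divff ?gt_eqF// mulr1; lra.
Qed.

Section single_solution.
Context {R : realType} {X : normedModType R} {ip : X -> X -> R} {n : nat}.
Hypothesis hX : euclidean ip n.
Variables (T : R) (A B : {linear X -> X}) (f ft : R -> X -> R) (g : R -> X -> X).
Hypothesis hA : sym_posdef ip A.
Hypothesis cf : continuous (fun p : R * X => f p.1 p.2).
Hypothesis cft : continuous (fun p : R * X => ft p.1 p.2).
Hypothesis hft : forall (s : R) x, 0 < s < T -> is_derive s 1 (f ^~ x) (ft s x).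
Hypothesis hfx : forall (t : R) x, 0 < t < T -> differentiable (f t) x.
Hypothesis hfg : forall (t : R) x y, 0 < t < T -> 'd (f t) x y = ip (g t x) y.

Variables (eps : R) (v w dw : R -> X).
Hypothesis eps0 : 0 < eps.
Hypothesis cv : continuous v.
Hypothesis cw : continuous w.
Hypothesis hv : forall t : R, 0 < t < T -> is_derive t 1 v (eps^-1 *: w t).
Hypothesis hw : forall t : R, 0 < t < T -> is_derive t 1 w (dw t).
Hypothesis ode : forall t : R, 0 < t < T ->
  eps *: A (dw t) + B (w t) + g t (v t) = 0.

Definition energy (s : R) := f s (v s) + 2^-1 * ip (A (w s)) (w s).

Lemma continuous_along (h : R -> X -> R) : continuous (fun p : R * X => h p.1 p.2) ->
  continuous (fun s => h s (v s)).
Proof.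
move=> ch s.
apply: (@continuous_comp _ _ _ (fun s => (s, v s)) (fun p : R * X => h p.1 p.2)).
  exact: continuous_graph.
exact: ch.
Qed.

Lemma energy_continuous : continuous energy.
Proof.
move=> s; apply: cvgD; first exact: continuous_along.
apply: cvgM; first exact: cvg_cst.
apply: (cvg_ip hX); last exact: cw.
apply: (@continuous_comp _ _ _ w A); first exact: cw.
exact: (euclidean_linear_continuous hX).
Qed.

(** Symmetry of [A] makes the kinetic term contribute [ip (A (dw t)) (w t)]; the equation paired
    with [w t] and divided by [eps] cancels it against the gradient term of the chain rule. *)
Lemma energy_derive (t : R) : 0 < t < T ->
  is_derive t 1 energy (ft t (v t) - eps^-1 * ip (B (w t)) (w t)).
Proof.
move=> tT.
have cfx x : continuous (f ^~ x).
  exact: continuous_slice cf.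
have h1 := is_derive_partial tT cfx hft cft (hfx (v t) tT) (hv tT).
have h2 := is_derive_ip hX (is_derive_linear hX A (hw tT)) (hw tT).
have h3 := is_derive1D h1 (is_derive1Z 2^-1 h2).
apply: is_derive_eq h3 _; rewrite hfg// (ipZr hX) /GRing.scale /=.
rewrite (ipC hX (A (w t))) -(hA.1 (dw t)).
have := congr1 (fun z => eps^-1 * ip z (w t)) (ode tT).
rewrite /= !(ipDl hX) (ipZl hX) (ip0l hX) mulr0 !mulrDr mulKf ?gt_eqF//.
by move: (ip (A _) _) (eps^-1 * _) (eps^-1 * _) => x y z; lra.
Qed.

(** Up to sign, [eps * (A w + B v)] is a primitive of the gradient along the solution. As soon as
    [v] and [w] are bounded it is [O(eps)], so the gradient integrates to almost nothing over any
    interval although the acceleration is not controlled. *)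
Lemma momentum_derive (z : X) (x : R) : 0 < x < T -> is_derive x 1
  (fun x => eps * (ip (A (w x)) z + ip (B (v x)) z)) (- ip (g x (v x)) z).
Proof.
move=> xT.
have h1 := is_derive_ip hX (is_derive_linear hX A (hw xT)) (is_derive_cst z x 1).
have h2 := is_derive_ip hX (is_derive_linear hX B (hv xT)) (is_derive_cst z x 1).
apply: is_derive_eq (is_derive1Z eps (is_derive1D h1 h2)) _.
rewrite !(ipC hX _ 0) !(ip0l hX) !addr0 linearZ (ipZl hX) /GRing.scale /=.
have := congr1 (fun y => ip y z) (ode xT).
rewrite /= !(ipDl hX) (ipZl hX) (ip0l hX) mulrDr mulVKf ?gt_eqF//.
by move: (eps * _) => y; lra.
Qed.

Lemma momentum_continuous (z : X) :
  continuous (fun x => eps * (ip (A (w x)) z + ip (B (v x)) z)).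
Proof.
move=> x; apply: cvgM; first exact: cvg_cst.
by apply: cvgD; apply: (cvg_ip hX); (try exact: cvg_cst);
  [apply: (@continuous_comp _ _ _ w A); first exact: cw
  |apply: (@continuous_comp _ _ _ v B); first exact: cv];
  exact: (euclidean_linear_continuous hX).
Qed.

(** * Bounds from Gronwall's inequality *)

Section bounds.
Variables C1 C2 : R.
Hypothesis C1gt0 : 0 < C1.
Hypothesis T0 : 0 < T.
Hypothesis hF2 : forall t x, 0 <= t <= T -> `|ft t x| <= C1 * f t x + C2.
Hypothesis hA0 : forall x, 0 <= ip (A x) x.
Hypothesis hB0 : forall x, 0 <= ip (B x) x.

(** The right-hand side of (F2) dominates an absolute value, so (F2) also bounds the potential from
    below. *)
Lemma potential_ge (t : R) x : 0 <= t <= T -> 0 <= f t x + C2 / C1.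
Proof.
move=> /(hF2 x) h; have := le_trans (normr_ge0 _) h.
by rewrite -(pmulr_rge0 (f t x + _) C1gt0) mulrDr mulrCA divff ?gt_eqF// mulr1.
Qed.

Lemma energy_le (t : R) : 0 <= t <= T ->
  energy t + C2 / C1 <= expR (C1 * T) * (energy 0 + C2 / C1).
Proof.
case/andP => t0 tT.
have H := @gronwall _ energy (fun s => ft s (v s) - eps^-1 * ip (B (w s)) (w s))
  0 t C1 C2 t0 C1gt0 energy_continuous (fun x hx => energy_derive
    (introT andP (conj (andP hx).1 (lt_le_trans (andP hx).2 tT)))).
apply: le_trans (H _) _.
  move=> x /andP[x0 xt].
  have hx : 0 <= x <= T by lra.
  have h1 := hF2 (v x) hx; have h2 := ler_norm (ft x (v x)).
  have h3 : 0 <= eps^-1 * ip (B (w x)) (w x) by rewrite mulr_ge0// invr_ge0 ltW.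
  have h4 : C1 * f x (v x) <= C1 * energy x.
    by apply: ler_wpM2l; [exact: ltW|rewrite /energy lerDl mulr_ge0// invr_ge0].
  by move: (ft _ _) (eps^-1 * _) (C1 * _) (C1 * _) `|_| h1 h2 h3 h4 => *; lra.
apply: ler_wpM2r.
  rewrite /energy addrAC addr_ge0// ?mulr_ge0// ?invr_ge0//.
  by apply: potential_ge; rewrite lexx ltW.
by rewrite ler_expR subr0; apply: ler_wpM2l => //; exact: ltW.
Qed.

(** The energy bounds the potential at the current time only, whereas (F1) asks for a bound at all
    times for a fixed point. Gronwall's inequality in both directions of time supplies it. *)
Lemma potential_le (s t : R) x : 0 <= s <= T -> 0 <= t <= T ->
  f s x + C2 / C1 <= expR (C1 * T) * (f t x + C2 / C1).
Proof.
move=> /andP[s0 sT] /andP[t0 tT].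
have cfx : continuous (f ^~ x).
  exact: continuous_slice cf.
have mono (a : R) : a <= T -> expR (C1 * a) * (f t x + C2 / C1) <=
    expR (C1 * T) * (f t x + C2 / C1).
  move=> aT; apply: ler_wpM2r; first by apply: potential_ge; rewrite t0.
  by rewrite ler_expR; apply: ler_wpM2l => //; exact: ltW.
have [st|ts] := leP s t.
- have hd y : s < y < t -> is_derive y 1 (f ^~ x) (ft y x).
    by move=> /andP[sy yt]; apply: hft; lra.
  have H := @gronwall_rev _ (f ^~ x) (ft ^~ x) s t C1 C2 st C1gt0 cfx hd.
  apply: le_trans (H _) (mono _ _); last by lra.
  move=> y /andP[sy yt]; have hy : 0 <= y <= T by lra.
  by have := hF2 x hy; have := ler_norm (- ft y x); rewrite normrN; lra.
- have hd y : t < y < s -> is_derive y 1 (f ^~ x) (ft y x).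
    by move=> /andP[sy yt]; apply: hft; lra.
  have H := @gronwall _ (f ^~ x) (ft ^~ x) t s C1 C2 (ltW ts) C1gt0 cfx hd.
  apply: le_trans (H _) (mono _ _); last by lra.
  move=> y /andP[sy yt]; have hy : 0 <= y <= T by lra.
  by have := hF2 x hy; have := ler_norm (ft y x); lra.
Qed.

End bounds.

(** * Consequences of a small dissipation *)

Section dissipation.
Variables (P : R -> R) (b aA aB : R).
Hypothesis cP : continuous P.
Hypothesis dP : forall t : R, 0 < t < T -> is_derive t 1 P (ft t (v t)).
Hypothesis b0 : 0 < b.
Hypothesis hb : forall x, b * `|x| ^+ 2 <= ip (B x) x.
Hypothesis aA0 : 0 < aA.
Hypothesis haA : forall x, `|A x| <= aA * `|x|.
Hypothesis aB0 : 0 < aB.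
Hypothesis haB : forall x, `|B x| <= aB * `|x|.

Definition total (s : R) := energy s - P s.

Lemma total_continuous : continuous total.
Proof. by move=> s; apply: cvgB; [exact: energy_continuous|exact: cP]. Qed.

Lemma total_derive (t : R) : 0 < t < T ->
  is_derive t 1 total (- (eps^-1 * ip (B (w t)) (w t))).
Proof.
move=> tT; apply: is_derive_eq (is_derive1B (energy_derive tT) (dP tT)) _; ring.
Qed.

Lemma total_nincr (s t : R) : 0 <= s -> s <= t -> t <= T -> total t <= total s.
Proof.
move=> s0 st tT; rewrite -subr_le0 -[leRHS](mul0r (t - s)).
apply: (derive_increment_le st total_continuous (df := fun t => - (eps^-1 * ip (B (w t)) (w t)))).
  by move=> x /andP[sx xt]; apply: total_derive; lra.
move=> x _; rewrite oppr_le0 mulr_ge0//; first by rewrite invr_ge0 ltW.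
by apply: le_trans (hb _); rewrite mulr_ge0// ltW.
Qed.

(* AM-GM: [|w| <= |w|^2 / (2 eta) + eta / 2], and the first term is paid for by
   the dissipation. *)
Lemma displacement_le (s t eta : R) : 0 <= s -> s <= t -> t <= T -> t - s <= eps ->
  0 < eta -> total s - total t <= b * eta ^+ 2 -> `|v t - v s| <= eta.
Proof.
move=> s0 st tT ste e0 cost.
set z := v t - v s.
have [->|z0] := eqVneq `|z| 0; first exact: ltW.
have {z0}z0 : 0 < `|z| by rewrite lt_def z0 normr_ge0.
(* Pairing with the displacement [z] itself reduces the vector estimate to a scalar one. This weight
   completes the square in [|w| - eta], and the whole dissipation then costs at most
   [c * (b * eta ^+ 2)], that is half of [|z| * eta]; the other half comes from the increment of
   [psi]. *)
pose c := `|z| / (2 * b * eta).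
have c0 : 0 < c by rewrite divr_gt0// !mulr_gt0.
pose psi (r : R) := ip (v r) z + c * total r.
have dpsi r : 0 < r < T -> is_derive r 1 psi
    (eps^-1 * (ip (w r) z - c * ip (B (w r)) (w r))).
  move=> rT; have h1 := is_derive_ip hX (hv rT) (is_derive_cst z r 1).
  apply: is_derive_eq (is_derive1D h1 (is_derive1Z c (total_derive rT))) _.
  by rewrite (ipZl hX) (ipC hX _ 0) (ip0l hX) /GRing.scale /=; ring.
have cpsi : continuous psi.
  move=> r; apply: cvgD; first by apply: (cvg_ip hX); [exact: cv|exact: cvg_cst].
  by apply: cvgM; [exact: cvg_cst|exact: total_continuous].
have : psi t - psi s <= eps^-1 * (`|z| * eta / 2) * (t - s).
  apply: (derive_increment_le st cpsi
    (df := fun r => eps^-1 * (ip (w r) z - c * ip (B (w r)) (w r)))).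
    by move=> x /andP[sx xt]; apply: dpsi; lra.
  move=> x _; apply: ler_wpM2l; first by rewrite invr_ge0 ltW.
  apply: (@le_trans _ _ (`|w x| * `|z| - c * (b * `|w x| ^+ 2))).
    by rewrite lerB// ?(ip_le hX)//; apply: ler_wpM2l => //; exact: ltW.
  have -> : `|w x| * `|z| - c * (b * `|w x| ^+ 2) =
    `|z| * eta / 2 - (`|z| / (2 * eta)) * (`|w x| - eta) ^+ 2.
    by rewrite /c; field; rewrite !gt_eqF.
  by rewrite gerBl mulr_ge0 ?sqr_ge0// divr_ge0 1?ltW// mulr_gt0.
have h1 : eps^-1 * (`|z| * eta / 2) * (t - s) <= `|z| * eta / 2.
  rewrite mulrAC ler_piMl//; first by rewrite divr_ge0// mulr_ge0// ltW.
  by rewrite mulrC ler_pdivrMr// mul1r.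
have h2 : `|z| ^+ 2 - `|z| * eta / 2 <= psi t - psi s.
  have -> : psi t - psi s = ip z z - c * (total s - total t).
    by rewrite /psi /z (ipBl hX); ring.
  rewrite (ip_norm hX) lerD2l lerN2.
  apply: (@le_trans _ _ (c * (b * eta ^+ 2))); first by apply: ler_wpM2l => //; exact: ltW.
  by rewrite le_eqVlt; apply/orP; left; apply/eqP; rewrite /c; field; rewrite !gt_eqF.
move=> h3; have : `|z| ^+ 2 <= `|z| * eta by move: h1 h2 h3; lra.
by rewrite expr2 ler_pM2l.
Qed.

(* Mean value theorem for [total]: its derivative is at most [- b |w|^2 / eps]. *)
Lemma slow_time (s t eta : R) : 0 <= s -> t <= T -> eps / 3 <= t - s ->
  0 < eta -> total s - total t <= b * eta ^+ 2 ->
  exists2 c, s < c < t & `|w c| <= 2 * eta.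
Proof.
move=> s0 tT ste e0 cost.
have ep := eps0; have st : s < t by lra.
have [x /andP[sx xt]|c cst] := derive_increment st total_continuous
  (df := fun t => - (eps^-1 * ip (B (w t)) (w t))).
  by apply: total_derive; lra.
move=> E; exists c => //.
have h1 : eps^-1 * ip (B (w c)) (w c) * (t - s) <= b * eta ^+ 2 by lra.
have h2 : b * `|w c| ^+ 2 / 3 <= eps^-1 * ip (B (w c)) (w c) * (t - s).
  have q : 3^-1 <= eps^-1 * (t - s).
    by rewrite mulrC ler_pdivlMr// mulrC.
  have -> : eps^-1 * ip (B (w c)) (w c) * (t - s) =
    ip (B (w c)) (w c) * (eps^-1 * (t - s)) by ring.
  by apply: ler_pM => //; rewrite mulr_ge0// ltW.
(* The interval has length at least a third of [eps], which gives [3 * eta ^+ 2], rounded up to a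
   square. *)
have h3 : `|w c| ^+ 2 <= (2 * eta) ^+ 2.
  have h4 : b * `|w c| ^+ 2 <= b * (3 * eta ^+ 2) by lra.
  rewrite ler_pM2l// in h4; have := sqr_ge0 eta; rewrite exprMn; lra.
by rewrite ler_sqr ?nnegrE// in h3; rewrite mulr_ge0// ltW.
Qed.

(* Integrate the equation between two times at distance at least [eps / 3] in a
   window of length [eps] around [r] where the velocity is small. *)
Lemma gradient_le (s t r eta om : R) (G0 : X) : 0 <= s -> t <= T ->
  eps <= t - s -> s <= r <= t -> 0 < eta -> total s - total t <= b * eta ^+ 2 ->
  (forall x : R, s <= x <= t -> `|x - r| <= eps -> `|g x (v x) - G0| <= om) ->
  `|G0| <= om + 3 * (4 * aA + aB) * eta.
Proof.
move=> s0 tT est /andP[sr rt] e0 cost hom.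
(* The window from [a] to [a + eps] contains [r] and stays inside [[s, t]] even when [r] is close to
   [t]. *)
have ep := eps0; pose a := Num.min r (t - eps).
have ar : a <= r by rewrite /a ge_min lexx.
have at' : a + eps <= t by rewrite -lerBrDr /a ge_min lexx orbT.
have sa : s <= a by rewrite /a le_min sr; lra.
have ra : r <= a + eps by rewrite /a; have [h|h] := leP r (t - eps); lra.
have mono x y : s <= x -> x <= y -> y <= t -> total x - total y <= b * eta ^+ 2.
  move=> sx xy yt; apply: le_trans cost; apply: lerB; apply: total_nincr; lra.
(* One slow time in the first third of the window and one in the last third are more than [eps / 3]
   apart. This is the factor 3 of the conclusion; the factor 4 adds the two speeds, each at most
   [2 * eta]. *)
have [p /andP[p1 p2] wp] : exists2 c, a < c < a + eps / 3 & `|w c| <= 2 * eta.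
  by apply: slow_time => //; [lra|lra|lra|apply: mono; lra].
have [q /andP[q1 q2] wq] : exists2 c, a + 2 * eps / 3 < c < a + eps & `|w c| <= 2 * eta.
  by apply: slow_time => //; [lra|lra|lra|apply: mono; lra].
have pq : p <= q by lra.
have dvpq : `|v q - v p| <= eta.
  by apply: displacement_le => //; [lra|lra|lra|apply: mono; lra].
have [G00|G00] := eqVneq `|G0| 0.
  rewrite G00 addr_ge0//; last by rewrite !mulr_ge0// ?addr_ge0 ?mulr_ge0// ltW.
  by apply: le_trans (hom r _ _) => //; rewrite ?sr// subrr normr0 ltW.
have {}G00 : 0 < `|G0| by rewrite lt_def G00 normr_ge0.
pose zeta (x : R) := eps * (ip (A (w x)) G0 + ip (B (v x)) G0).
have dzeta x : 0 < x < T -> is_derive x 1 zeta (- ip (g x (v x)) G0).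
  exact: momentum_derive.
have czeta : continuous zeta by exact: momentum_continuous.
have h1 : zeta q - zeta p <= (om * `|G0| - `|G0| ^+ 2) * (q - p).
  apply: (derive_increment_le pq czeta (df := fun x => - ip (g x (v x)) G0)).
    by move=> x /andP[px xq]; apply: dzeta; lra.
  move=> x /andP[px xq].
  have -> : ip (g x (v x)) G0 = ip (g x (v x) - G0) G0 + `|G0| ^+ 2.
    by rewrite (ipBl hX) (ip_norm hX) subrK.
  rewrite opprD lerD2r.
  apply: (@le_trans _ _ (`|g x (v x) - G0| * `|G0|)).
    by rewrite -(ipNl hX) (le_trans (ip_le hX _ _))// normrN.
  rewrite ler_wpM2r//; apply: hom; first by lra.
  rewrite ler_norml; lra.
have h2 : - (eps * ((4 * aA + aB) * eta * `|G0|)) <= zeta q - zeta p.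
  have -> : zeta q - zeta p = - (eps * (ip (A (w p - w q)) G0 + ip (B (v p - v q)) G0)).
    by rewrite /zeta !linearB !(ipBl hX); ring.
  rewrite lerN2; apply: ler_wpM2l; first exact: ltW.
  apply: (@le_trans _ _ (`|A (w p - w q)| * `|G0| + `|B (v p - v q)| * `|G0|)).
    by rewrite lerD// (ip_le hX).
  rewrite -mulrDl ler_wpM2r//.
  have k1 : `|w p - w q| <= 4 * eta.
    by rewrite (le_trans (ler_normB _ _))//; lra.
  have k2 : `|v p - v q| <= eta by rewrite distrC.
  rewrite mulrDl lerD//; apply: (le_trans (haA _)) || apply: (le_trans (haB _)).
    by rewrite (mulrC 4) -mulrA; apply: ler_wpM2l => //; exact: ltW.
  by apply: ler_wpM2l => //; exact: ltW.
have h3 : (`|G0| - om) * (q - p) <= eps * ((4 * aA + aB) * eta).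
  rewrite -(ler_pM2r G00); move: (le_trans h2 h1); rewrite expr2.
  by move: (4 * aA + aB) (q - p) `|G0| => x y z; nra.
have [h4|h4] := leP `|G0| om.
  apply: (le_trans h4); rewrite lerDl !mulr_ge0// ?addr_ge0 ?mulr_ge0// ltW//.
have h5 : (`|G0| - om) * (eps / 3) <= eps * ((4 * aA + aB) * eta).
  apply: le_trans h3; rewrite ler_wpM2l//; first by rewrite subr_ge0 ltW.
  lra.
rewrite mulrCA ler_pM2l// in h5; move: h5; move: ((4 * aA + aB)) => x h5.
by rewrite -mulrA; move: (x * eta) h5 => y; lra.
Qed.

(* The kinetic energy is at most [aA / (2 b)] times [<B w, w>], so its integral is
   [O(eps)]. *)
Lemma energy_average (Pf : R -> R) (K s t : R) : continuous Pf ->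
  (forall r : R, 0 < r < T -> is_derive r 1 Pf (f r (v r))) ->
  (forall r : R, 0 <= r <= T -> `|ft r (v r)| <= K) ->
  0 <= s -> s < t -> t <= T ->
  (energy t - K * (t - s)) * (t - s) <=
    Pf t - Pf s + aA / (2 * b) * eps * (total s - total t).
Proof.
move=> cPf dPf hK s0 st tT.
pose c := aA / (2 * b) * eps.
have c0 : 0 < c by rewrite mulr_gt0// divr_gt0// mulr_gt0.
(* With this [c] the derivative of [Z] is the potential plus a multiple of the dissipation rate that
   dominates the kinetic energy, so it is at least [energy r]. The mean value theorem then replaces
   an integral of the energy. *)
pose Z (r : R) := Pf r - c * total r.
have dZ r : s < r < t -> is_derive r 1 Z
    (f r (v r) + aA / (2 * b) * ip (B (w r)) (w r)).
  move=> /andP[sr rt]; have rT : 0 < r < T by lra.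
  apply: is_derive_eq (is_derive1B (dPf _ rT) (is_derive1Z c (total_derive rT))) _.
  by rewrite /c /GRing.scale /=; field; rewrite !gt_eqF.
have cZ : continuous Z.
  move=> r; apply: cvgB; first exact: cPf.
  by apply: cvgM; [exact: cvg_cst|exact: total_continuous].
have [r /andP[sr rt] E] := derive_increment st cZ dZ.
have h1 : energy r <= f r (v r) + aA / (2 * b) * ip (B (w r)) (w r).
  rewrite /energy lerD2l.
  apply: (@le_trans _ _ (2^-1 * (aA * `|w r| ^+ 2))).
    rewrite ler_wpM2l ?invr_ge0// (le_trans (ip_le hX _ _))//.
    by rewrite expr2 mulrA ler_wpM2r.
  have -> : 2^-1 * (aA * `|w r| ^+ 2) = aA / (2 * b) * (b * `|w r| ^+ 2).
    by field; rewrite gt_eqF.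
  by apply: ler_wpM2l => //; rewrite divr_ge0 ?mulr_ge0// ltW.
(* Only [total] is monotone; the correction pays for the variation of the primitive [P] between [r]
   and [t]. *)
have h2 : energy t - K * (t - s) <= energy r.
  have h3 : total t <= total r by apply: total_nincr; lra.
  have h4 : P t - P r <= K * (t - r).
    apply: (derive_increment_le (ltW rt) cP (df := fun x => ft x (v x))).
      by move=> x /andP[rx xt]; apply: dP; lra.
    move=> x /andP[rx xt]; apply: le_trans (ler_norm _) (hK _ _); lra.
  have h5 : K * (t - r) <= K * (t - s).
    apply: ler_wpM2l; last by lra.
    by apply: le_trans (normr_ge0 _) (hK r _); lra.
  by move: h3; rewrite /total; lra.
have -> : Pf t - Pf s + aA / (2 * b) * eps * (total s - total t) = Z t - Z s.
  by rewrite /Z /c; ring.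
rewrite E; apply: ler_wpM2r; first by lra.
exact: le_trans h2 h1.
Qed.

Lemma momentum_identity (Pg : R -> R) (z : X) (s t : R) : continuous Pg ->
  (forall r : R, 0 < r < T -> is_derive r 1 Pg (ip (g r (v r)) z)) ->
  0 <= s -> s <= t -> t <= T ->
  Pg t - Pg s = eps * (ip (A (w s - w t)) z + ip (B (v s - v t)) z).
Proof.
move=> cPg dPg s0 st tT.
have [<-|st'] := eqVneq s t; first by rewrite !subrr !linear0 !(ip0l hX) addr0 mulr0.
have {}st : s < t by rewrite lt_def eq_sym st'.
pose Z (x : R) := Pg x + eps * (ip (A (w x)) z + ip (B (v x)) z).
have cZ : continuous Z.
  by move=> x; apply: cvgD; [exact: cPg|exact: momentum_continuous].
have dZ x : s < x < t -> is_derive x 1 Z 0.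
  move=> /andP[sx xt]; have xT : 0 < x < T by lra.
  by apply: is_derive_eq (is_derive1D (dPg _ xT) (momentum_derive z xT)) (addrN _).
have [r _] := derive_increment st cZ (df := fun=> 0) dZ.
rewrite mul0r /Z => E; rewrite !linearB !(ipBl hX).
move: (Pg t) (Pg s) (ip (A (w t)) z) (ip (B (v t)) z) (ip (A (w s)) z) E.
by move: (ip (B (v s)) z) => *; lra.
Qed.

End dissipation.

End single_solution.

(** * The limit of vanishing inertia *)

Lemma continuous_section {R : realType} {X Z : normedModType R} (h : R -> X -> Z)
    (t : R) : continuous (fun p : R * X => h p.1 p.2) -> continuous (h t).
Proof.
move=> ch x; apply: (@continuous_comp _ _ _ (fun x => (t, x)) (fun p : R * X => h p.1 p.2)).
  apply: (@cvg_pair _ _ _ (nbhs x) (nbhs t) (nbhs x)); first exact: cvg_cst.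
  exact: cvg_id.
exact: ch.
Qed.

Section vanishing_inertia.
Context {R : realType} {X : normedModType R} {ip : X -> X -> R} {n : nat}.
Hypothesis hX : euclidean ip n.
Variables (T : R) (A B : {linear X -> X}) (f ft : R -> X -> R) (g : R -> X -> X).
Hypothesis T0 : 0 < T.
Hypothesis hA : sym_posdef ip A.
Hypothesis hB : sym_posdef ip B.
Hypothesis cf : continuous (fun p : R * X => f p.1 p.2).
Hypothesis cft : continuous (fun p : R * X => ft p.1 p.2).
Hypothesis cg : continuous (fun p : R * X => g p.1 p.2).
Hypothesis hft : forall (s : R) x, 0 < s < T -> is_derive s 1 (f ^~ x) (ft s x).
Hypothesis hfx : forall (t : R) x, 0 < t < T -> differentiable (f t) x.
Hypothesis hfg : forall (t : R) x y, 0 < t < T -> 'd (f t) x y = ip (g t x) y.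
Hypothesis hlip : forall x, exists L rho : R, [/\ 0 <= L, 0 < rho &
  forall y, `|y - x| < rho -> forall s t : R, 0 <= s <= T -> 0 <= t <= T ->
    `|g s y - g t y| <= L * `|s - t|].
Hypothesis hiso : forall (t : R) x, 0 <= t <= T -> g t x = 0 ->
  exists2 rho : R, 0 < rho & forall y, 0 < `|y - x| <= rho -> g t y != 0.
Hypothesis hslope : forall (t : R) x, 0 <= t <= T -> g t x = 0 ->
  forall eta : R, 0 < eta -> exists2 rho : R, 0 < rho &
  forall y, `|y - x| < rho -> - (eta * `|g t y|) <= f t y - f t x.

Variables (e : nat -> R) (v w dw : nat -> R -> X).
Hypothesis e_gt0 : forall k, 0 < e k.
Hypothesis e_cvg0 : e k @[k --> \oo] --> (0 : R).
Hypothesis cv : forall k, continuous (v k).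
Hypothesis cw : forall k, continuous (w k).
Hypothesis hv : forall k (t : R), 0 < t < T -> is_derive t 1 (v k) ((e k)^-1 *: w k t).
Hypothesis hw : forall k (t : R), 0 < t < T -> is_derive t 1 (w k) (dw k t).
Hypothesis ode : forall k (t : R), 0 < t < T ->
  e k *: A (dw k t) + B (w k t) + g t (v k t) = 0.
Variables M W : R.
Hypothesis hM : forall k (t : R), 0 <= t <= T -> `|v k t| <= M.
Hypothesis hW : forall k (t : R), 0 <= t <= T -> `|w k t| <= W.
Hypothesis hw0 : w k 0 @[k --> \oo] --> (0 : X).

Variables u um up : R -> X.
Hypothesis hu : forall t : R, 0 <= t <= T -> v k t @[k --> \oo] --> u t.
Hypothesis hum : forall t : R, 0 < t <= T -> forall eta : R, 0 < eta ->
  exists2 d : R, 0 < d <= t & forall s, t - d < s < t -> `|u s - um t| < eta.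
Hypothesis hup : forall t : R, 0 <= t < T -> forall eta : R, 0 < eta ->
  exists2 d : R, 0 < d <= T - t & forall s, t < s < t + d -> `|u s - up t| < eta.
Hypothesis hum0 : um 0 = u 0.
Hypothesis hupT : up T = u T.

Lemma bounded_on_cylinder (h : R -> X -> R) :
  continuous (fun p : R * X => h p.1 p.2) ->
  exists2 K : R, 0 < K & forall (t : R) x, 0 <= t <= T -> `|x| <= M -> `|h t x| <= K.
Proof.
move=> ch.
have cK : compact (`[0, T]%classic `*` [set x : X | `|x| <= M]).
  apply: compact_setX; first exact: segment_compact.
  exact: (closed_ball_compact hX).
have [K K0 hK] := compact_upper_bound cK ch.
by exists K => // t x tT xM; apply: (hK (t, x)); split => //=; rewrite in_itv.
Qed.

Lemma cvg_along (h : R -> X -> R) (t : R) :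
  continuous (fun p : R * X => h p.1 p.2) -> 0 <= t <= T ->
  h t (v k t) @[k --> \oo] --> h t (u t).
Proof.
move=> ch tT.
exact: (cvg_comp _ _ (hu tT) (@continuous_section _ _ _ h t ch (u t))).
Qed.

(** Used for [ft], for [f] and for [g] paired with a fixed vector. The trajectories stay in a
    compact cylinder, which provides the dominating constant. *)
Lemma antiderivative_along (h : R -> X -> R) :
  continuous (fun p : R * X => h p.1 p.2) ->
  exists (P : nat -> R -> R) (I : R -> R), [/\
    forall k, continuous (P k),
    forall k (t : R), 0 < t < T -> is_derive t 1 (P k) (h t (v k t)),
    forall (t : R), 0 <= t <= T -> P k t @[k --> \oo] --> I t,
    forall (s t : R), 0 <= s -> s <= t -> t <= T ->
      (\int[lebesgue_measure]_(r in `[s, t]%classic) (h r (u r))%:E = (I t - I s)%:E)%E &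
    forall (s t c : R), 0 <= s -> s <= t -> t <= T ->
      ((forall r : R, s < r < t -> h r (u r) <= c) -> I t - I s <= c * (t - s)) /\
      ((forall r : R, s < r < t -> c <= h r (u r)) -> c * (t - s) <= I t - I s)].
Proof.
move=> ch; have [K _ hK] := bounded_on_cylinder ch.
apply: (@antiderivative_limit _ T K (fun k t => h t (v k t)) (fun t => h t (u t))).
- exact: ltW.
- by move=> k; exact: continuous_along.
- by move=> k t tT; apply: hK => //; exact: hM.
- by move=> t tT; exact: cvg_along.
Qed.

Lemma one_sided_in (a b s eta : R) (x : X) : 0 <= a -> a < s < b -> b <= T ->
  (forall r, a < r < b -> `|u r - x| <= eta) ->
  `|um s - x| <= eta /\ `|up s - x| <= eta.
Proof.
move=> a0 /andP[as' sb] bT hr; split; apply/ler_addgt0Pr => d d0.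
- have sT : 0 < s <= T by lra.
  have [d' /andP[d'0 d's] hd'] := hum sT d0.
  pose r := Num.max (s - d' / 2) ((a + s) / 2).
  have r1 : s - d' < r by rewrite lt_max; apply/orP; left; lra.
  have r2 : r < s by rewrite gt_max; apply/andP; split; lra.
  have r3 : a < r by rewrite lt_max; apply/orP; right; lra.
  have h1 := hd' r (introT andP (conj r1 r2)).
  have h2 := hr r (introT andP (conj r3 (lt_trans r2 sb))).
  by apply: le_trans (ler_distD (u r) _ _) _; rewrite (distrC (um s)); lra.
- have sT : 0 <= s < T by lra.
  have [d' /andP[d'0 d's] hd'] := hup sT d0.
  pose r := Num.min (s + d' / 2) ((b + s) / 2).
  have r1 : r < s + d' by rewrite gt_min; apply/orP; left; lra.
  have r2 : s < r by rewrite lt_min; apply/andP; split; lra.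
  have r3 : r < b by rewrite gt_min; apply/orP; right; lra.
  have h1 := hd' r (introT andP (conj r2 r1)).
  have h2 := hr r (introT andP (conj (lt_trans as' r2) r3)).
  by apply: le_trans (ler_distD (u r) _ _) _; rewrite (distrC (up s)); lra.
Qed.

(** The one-sided limits at nearby points are controlled together with [u]: criticality is
    established for [um] and [up] only, not for the values of [u]. *)
Lemma left_close (t d0 : R) : 0 < t <= T -> 0 < d0 ->
  exists2 d : R, 0 < d <= t & forall s, t - d < s < t ->
    [/\ `|s - t| < d0, `|u s - um t| < d0, `|um s - um t| < d0 & `|up s - um t| < d0].
Proof.
move=> tT d00; have d02 : 0 < d0 / 2 by lra.
have [d /andP[d1 dt] hd] := hum tT d02.
pose d' := Num.min d d0; exists d'.
  by rewrite lt_min d1 d00 /= ge_min dt.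
have d'd : d' <= d by rewrite ge_min lexx.
have d'd0 : d' <= d0 by rewrite ge_min lexx orbT.
move=> s /andP[s1 s2].
have [h1 h2] : `|um s - um t| <= d0 / 2 /\ `|up s - um t| <= d0 / 2.
  apply: (@one_sided_in (t - d) t); [lra|lra|lra|].
  by move=> r hr; apply: ltW; exact: hd.
have h3 : `|u s - um t| < d0 / 2 by apply: hd; lra.
split; [|lra|lra|lra].
by rewrite ltr0_norm; lra.
Qed.

Lemma right_close (t d0 : R) : 0 <= t < T -> 0 < d0 ->
  exists2 d : R, 0 < d <= T - t & forall s, t < s < t + d ->
    [/\ `|s - t| < d0, `|u s - up t| < d0, `|um s - up t| < d0 & `|up s - up t| < d0].
Proof.
move=> tT d00; have d02 : 0 < d0 / 2 by lra.
have [d /andP[d1 dt] hd] := hup tT d02.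
pose d' := Num.min d d0; exists d'.
  by rewrite lt_min d1 d00 /= ge_min dt.
have d'd : d' <= d by rewrite ge_min lexx.
have d'd0 : d' <= d0 by rewrite ge_min lexx orbT.
move=> s /andP[s1 s2].
have [h1 h2] : `|um s - up t| <= d0 / 2 /\ `|up s - up t| <= d0 / 2.
  apply: (@one_sided_in t (t + d)); [lra|lra|lra|].
  by move=> r hr; apply: ltW; exact: hd.
have h3 : `|u s - up t| < d0 / 2 by apply: hd; lra.
split; [|lra|lra|lra].
by rewrite gtr0_norm; lra.
Qed.

(** If the gradient [z] at a one-sided limit were nonzero, its pairing with [z] would exceed half of
    [|z|^2] along [u] on a short interval on that side. The integral would be positive, while the
    momentum identity makes it a limit of [O(e k)] quantities. *)
Lemma critical_one_sided : (forall t : R, 0 <= t < T -> g t (up t) = 0) /\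
  (forall t : R, 0 < t <= T -> g t (um t) = 0).
Proof.
have [aA aA0 haA] := euclidean_linear_bounded hX A.
have [aB aB0 haB] := euclidean_linear_bounded hX B.
have cgz (z : X) : continuous (fun p : R * X => ip (g p.1 p.2) z).
  by move=> p; apply: (cvg_ip hX); [exact: cg|exact: cvg_cst].
have zero (z : X) (s t c : R) : 0 <= s -> s < t -> t <= T -> 0 < c ->
    (forall r : R, s < r < t -> c <= ip (g r (u r)) z) -> False.
  move=> s0 st tT c0 hc.
  have [P [I [cP dP cvP _ hI]]] := @antiderivative_along (fun r x => ip (g r x) z) (cgz z).
  have [_ /(_ hc)] := hI s t c s0 (ltW st) tT.
  suff -> : I t - I s = 0.
    by rewrite leNgt mulr_gt0// subr_gt0.
  have h1 : P k t - P k s @[k --> \oo] --> I t - I s.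
    by apply: cvgB; apply: cvP; lra.
  have h2 : P k t - P k s @[k --> \oo] --> 0.
    apply/norm_cvg0P.
    apply: (@squeeze_cvgr _ _ _ _ (cst 0)
      (fun k => e k * ((aA * (W + W) + aB * (M + M)) * `|z|))).
    - apply: nearW => k; rewrite normr_ge0 /=.
      rewrite (momentum_identity hX (@e_gt0 k) (@cv k) (@cw k) (@hv k) (@hw k)
        (@ode k) (cP k) (dP k) s0 (ltW st) tT).
      rewrite normrM gtr0_norm//; apply: ler_wpM2l; first exact: ltW.
      rewrite (le_trans (ler_normD _ _))// mulrDl lerD//.
        rewrite (le_trans (ip_normr hX _ _))//; apply: ler_wpM2r => //.
        apply: le_trans (haA _) _; apply: ler_wpM2l; first exact: ltW.
        by rewrite (le_trans (ler_normB _ _))// lerD// hW//; lra.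
      rewrite (le_trans (ip_normr hX _ _))//; apply: ler_wpM2r => //.
      apply: le_trans (haB _) _; apply: ler_wpM2l; first exact: ltW.
      by rewrite (le_trans (ler_normB _ _))// lerD// hM//; lra.
    - exact: cvg_cst.
    - rewrite -[X in _ --> X](mul0r ((aA * (W + W) + aB * (M + M)) * `|z|)).
      by apply: cvgM => //; exact: cvg_cst.
  exact: (cvg_unique _ h1 h2).
split=> t tT; apply/eqP; apply: contraT => g0.
- set z := g t (up t) in g0; have z0 : 0 < `|z| ^+ 2 / 2.
    by rewrite divr_gt0// exprn_gt0// normr_gt0.
  have [d0 d00 hd0] := @continuous2_dist _ _ _ (fun r x => ip (g r x) z) (cgz z) t (up t) _ z0.
  have [d /andP[d1 d2] hd] := right_close tT d00.
  exfalso; apply: (zero z t (t + d) _ _ _ _ z0); [lra|lra|lra|].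
  move=> r /hd[h1 h2 _ _]; have := hd0 _ _ h1 h2.
  by rewrite -/z (ip_norm hX) ltr_norml; lra.
- set z := g t (um t) in g0; have z0 : 0 < `|z| ^+ 2 / 2.
    by rewrite divr_gt0// exprn_gt0// normr_gt0.
  have [d0 d00 hd0] := @continuous2_dist _ _ _ (fun r x => ip (g r x) z) (cgz z) t (um t) _ z0.
  have [d /andP[d1 d2] hd] := left_close tT d00.
  exfalso; apply: (zero z (t - d) t _ _ _ _ z0); [lra|lra|lra|].
  move=> r /hd[h1 h2 _ _]; have := hd0 _ _ h1 h2.
  by rewrite -/z (ip_norm hX) ltr_norml; lra.
Qed.

(** * The energy balance in the limit *)

Section energy_limit.
Variables (P : nat -> R -> R) (I : R -> R).
Hypothesis cP : forall k, continuous (P k).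
Hypothesis dP : forall k (t : R), 0 < t < T -> is_derive t 1 (P k) (ft t (v k t)).
Hypothesis cvP : forall t : R, 0 <= t <= T -> P k t @[k --> \oo] --> I t.
Hypothesis hI : forall s t c : R, 0 <= s -> s <= t -> t <= T ->
  ((forall r : R, s < r < t -> ft r (u r) <= c) -> I t - I s <= c * (t - s)) /\
  ((forall r : R, s < r < t -> c <= ft r (u r)) -> c * (t - s) <= I t - I s).

Let E k := @energy R X ip A f (v k) (w k).
Let Q k := @total R X ip A f (v k) (w k) (P k).
Let fm t := f t (um t) - I t.
Let fp t := f t (up t) - I t.

Let A0 x : 0 <= ip (A x) x.
Proof.
have [->|x0] := eqVneq x 0; first by rewrite linear0 (ip0l hX).
exact/ltW/hA.2.
Qed.

Let Q_nincr k (s t : R) : 0 <= s -> s <= t -> t <= T -> Q k t <= Q k s.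
Proof.
have [b b0 hb] := sym_posdef_coercive hX hB.
move=> s0 st tT; rewrite /Q.
apply: (total_nincr hX hA cf cft hft hfx hfg (@e_gt0 k) (@cv k) (@cw k) (@hv k) (@hw k)
  (@ode k) (@cP k) (@dP k) b0 hb) => //.
Qed.

Lemma energy_limsup (t eta : R) : 0 <= t <= T -> 0 < eta ->
  \forall k \near \oo, E k t <= f t (um t) + eta.
Proof.
case/andP; rewrite le_eqVlt => /orP[/eqP <- _|t0 tT] eta0.
  (* At time 0 there is no past to average over; the kinetic energy vanishes by the assumption on
     the initial velocities. *)
  have h1 : f 0 (v k 0) @[k --> \oo] --> f 0 (u 0).
    by apply: (cvg_along cf); rewrite lexx ltW.
  have h2 : 2^-1 * ip (A (w k 0)) (w k 0) @[k --> \oo] --> 2^-1 * ip (A 0) (0 : X).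
    apply: cvgM; first exact: cvg_cst.
    apply: (cvg_ip hX) => //.
    exact: (cvg_comp _ _ hw0 (@euclidean_linear_continuous _ _ _ _ hX A 0)).
  have h3 : E k 0 @[k --> \oo] --> f 0 (u 0) + 2^-1 * ip (A 0) (0 : X).
    exact: cvgD.
  rewrite linear0 (ip0l hX) mulr0 addr0 in h3.
  by rewrite hum0; apply: cvgr_le h3 _ _; rewrite ltrDl.
have tT' : 0 < t <= T by rewrite t0.
have [aA aA0 haA] := euclidean_linear_bounded hX A.
have [b b0 hb] := sym_posdef_coercive hX hB.
have [K K0 hK] := bounded_on_cylinder cft.
have [Kf Kf0 hKf] := bounded_on_cylinder cf.
have [Pf [If [cPf dPf cvPf _ hIf]]] := antiderivative_along cf.
(* The four quarters pay for the oscillation of [f] along [u] on the window, the drift [K * d], the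
   convergence of [Pf], and the kinetic term [e k * C]. The length [d] is fixed before [k], so the
   last two can be made small relative to [d]. *)
have eta4 : 0 < eta / 4 by lra.
have [d0 d00 hd0] := continuous2_dist cf t (um t) eta4.
have [d1 /andP[d10 d1t] hd1] := left_close tT' d00.
pose d := Num.min d1 (eta / 4 / K).
have dd1 : d <= d1 by rewrite ge_min lexx.
have d_gt0 : 0 < d by rewrite lt_min d10 divr_gt0.
have Kd : K * d <= eta / 4 by rewrite mulrC -ler_pdivlMr// ge_min lexx orbT.
have s0 : 0 <= t - d by lra.
have st : t - d < t by lra.
have hIfd : If t - If (t - d) <= (f t (um t) + eta / 4) * d.
  have [H _] := hIf (t - d) t (f t (um t) + eta / 4) s0 (ltW st) tT.
  rewrite [X in _ * X](_ : d = t - (t - d)); last by lra.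
  apply: H => r /andP[r1 r2].
  have [|k1 k2 _ _] := hd1 r; first by lra.
  by have := hd0 _ _ k1 k2; rewrite ltr_norml; lra.
(* The second factor bounds the dissipation on the window: potential and kinetic energy at its
   start, the potential from below at its end, and the variation of [P k]. *)
pose C := aA / (2 * b) * (Kf + 2^-1 * (aA * W ^+ 2) + Kf + K * T).
have cvC : e k * C @[k --> \oo] --> 0.
  by rewrite -[X in _ --> X](mul0r C); apply: cvgM => //; exact: cvg_cst.
have cvPd : Pf k t - Pf k (t - d) @[k --> \oo] --> If t - If (t - d).
  by apply: cvgB; apply: cvPf; lra.
have etad : 0 < eta / 4 * d by rewrite mulr_gt0.
have n1 : \forall k \near \oo, e k * C <= eta / 4 * d by apply: cvgr_le cvC _ etad.
have n2 : \forall k \near \oo, Pf k t - Pf k (t - d) <= If t - If (t - d) + eta / 4 * d.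
  by apply: cvgr_le cvPd _ _; rewrite ltrDl.
apply: filterS2 n1 n2 => k n1 n2.
have := energy_average hX hA cf cft hft hfx hfg (@e_gt0 k) (@cv k) (@cw k) (@hv k) (@hw k)
  (@ode k) (@cP k) (@dP k) b0 hb aA0 haA (cPf k) (dPf k)
  (fun r hr => hK r (v k r) hr (@hM k r hr)) s0 st tT.
rewrite -/(E k t) -/(Q k t) -/(Q k (t - d)) (_ : t - (t - d) = d); last by lra.
move=> H.
have HQ : aA / (2 * b) * e k * (Q k (t - d) - Q k t) <= e k * C.
  rewrite (mulrC _ (e k)) -mulrA /C; apply: ler_wpM2l; first exact: ltW.
  apply: ler_wpM2l; first by rewrite divr_ge0 ?mulr_ge0// ltW.
  have tT0 : 0 <= t - d <= T by lra.
  have k1 : f (t - d) (v k (t - d)) <= Kf.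
    by apply: le_trans (ler_norm _) _; apply: hKf => //; exact: hM.
  have k2 : - Kf <= f t (v k t).
    have h : 0 <= t <= T by lra.
    by have := hKf t (v k t) h (@hM k t h); rewrite ler_norml; lra.
  have k3 : 2^-1 * ip (A (w k (t - d))) (w k (t - d)) <= 2^-1 * (aA * W ^+ 2).
    apply: ler_wpM2l => //; apply: le_trans (ip_le hX _ _) _.
    rewrite expr2 mulrA; apply: ler_pM => //; last exact: hW.
    by apply: le_trans (haA _) _; apply: ler_wpM2l; [exact: ltW|exact: hW].
  have k4 : 0 <= 2^-1 * ip (A (w k t)) (w k t) by rewrite mulr_ge0.
  have k5 : P k t - P k (t - d) <= K * (t - (t - d)).
    apply: (derive_increment_le (ltW st) (@cP k) (df := fun x => ft x (v k x))).
      by move=> x /andP[rx xt]; apply: dP; lra.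
    move=> x /andP[rx xt]; have h : 0 <= x <= T by lra.
    by apply: le_trans (ler_norm _) _; apply: hK => //; exact: hM.
  have k6 : K * (t - (t - d)) <= K * T by apply: ler_wpM2l; [exact: ltW|lra].
  by rewrite /Q /total /energy; lra.
rewrite -(ler_pM2r d_gt0); have : K * d * d <= eta / 4 * d by rewrite ler_pM2r.
by move: H; rewrite mulrBl mulrDl; lra.
Qed.

Let sub_itv (s t : R) : 0 <= s -> s <= t -> t <= T -> 0 <= s <= T /\ 0 <= t <= T.
Proof. by move=> *; split; lra. Qed.

(** At [t] the energy is bounded below by the potential, which converges to its value at [u t]; at
    [s] it is bounded above by [energy_limsup]. A dissipation [D] that persists along the sequence
    survives in the limit. *)
Lemma balance_le_gap (s t D : R) : 0 <= s -> s <= t -> t <= T ->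
  (\forall k \near \oo, D <= Q k s - Q k t) -> f t (u t) - I t + D <= fm s.
Proof.
move=> s0 st tT hD; have [hs ht] := sub_itv s0 st tT.
apply/ler_addgt0Pr => eta eta0.
have h1 : f t (v k t) - P k t + D @[k --> \oo] --> f t (u t) - I t + D.
  by apply: cvgD; [apply: cvgB; [exact: (cvg_along cf)|exact: cvP]|exact: cvg_cst].
have h2 : f s (um s) + eta - P k s @[k --> \oo] --> f s (um s) + eta - I s.
  by apply: cvgB; [exact: cvg_cst|exact: cvP].
have -> : fm s + eta = f s (um s) + eta - I s by rewrite /fm; lra.
apply: (ler_cvg_to h1 h2); apply: filterS2 hD (energy_limsup hs eta0) => k hk hE.
have k4 : 0 <= 2^-1 * ip (A (w k t)) (w k t) by rewrite mulr_ge0.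
by move: hk hE; rewrite /Q /total /E /energy; lra.
Qed.

Lemma balance_le (s t : R) : 0 <= s -> s <= t -> t <= T -> f t (u t) - I t <= fm s.
Proof.
move=> s0 st tT; rewrite -[leLHS]addr0; apply: balance_le_gap => //.
by apply: nearW => k; rewrite subr_ge0; exact: Q_nincr.
Qed.

Lemma primitive_lipschitz : exists2 K : R, 0 < K & forall s t : R, 0 <= s <= T ->
  0 <= t <= T -> `|I s - I t| <= K * `|s - t|.
Proof.
have [K K0 hK] := bounded_on_cylinder cft; exists K => //.
have bu (r : R) : 0 <= r <= T -> `|ft r (u r)| <= K.
  move=> rT.
  have h : `|ft r (v k r)| @[k --> \oo] --> `|ft r (u r)|.
    by apply: cvg_norm; exact: (cvg_along cft rT).
  apply: (cvgr_to_le h); apply: nearW => k.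
  by apply: hK => //; exact: hM.
have one (s t : R) : 0 <= s -> s <= t -> t <= T -> `|I s - I t| <= K * `|s - t|.
  move=> s0 st tT; rewrite distrC (distrC s) (ger0_norm (x := t - s)) ?subr_ge0//.
  have [h1 _] := hI K s0 st tT; have [_ h2] := hI (- K) s0 st tT.
  rewrite ler_norml -mulNr h1 ?h2//.
    move=> r hr; have : 0 <= r <= T by lra.
    by move/bu; rewrite ler_norml => /andP[].
  move=> r hr; have : 0 <= r <= T by lra.
  by move/bu; rewrite ler_norml => /andP[].
move=> s t hs ht; have [st|ts] := leP s t; first by apply: one => //; lra.
by rewrite distrC (distrC s); apply: one => //; lra.
Qed.

Lemma balance_left (t eta : R) : 0 < t <= T -> 0 < eta ->
  exists2 d : R, 0 < d <= t & forall s, t - d < s < t ->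
    [/\ `|u s - um t| < eta, `|f s (u s) - I s - fm t| < eta,
        `|fm s - fm t| < eta & `|fp s - fm t| < eta].
Proof.
move=> tT eta0; have [K K0 hK] := primitive_lipschitz.
have eta2 : 0 < eta / 2 by lra.
have [d0 d00 hd0] := continuous2_dist cf t (um t) eta2.
pose d1 := Num.min d0 (Num.min eta (eta / 2 / K)).
have d10 : 0 < d1 by rewrite !lt_min d00 eta0 /= divr_gt0.
have d1d0 : d1 <= d0 by rewrite ge_min lexx.
have d1e : d1 <= eta by rewrite /d1 !ge_min lexx orbT.
have d1K : d1 <= eta / 2 / K by rewrite /d1 !ge_min lexx !orbT.
have [d d2 hd] := left_close tT d10; exists d => // s hs.
have [h1 h2 h3 h4] := hd s hs.
have hIs : `|I s - I t| <= eta / 2.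
  apply: le_trans (hK s t _ _) _; [case/andP: d2; lra|lra|].
  by rewrite mulrC -ler_pdivlMr//; apply: le_trans (ltW h1) d1K.
have close y : `|y - um t| < d1 -> `|f s y - I s - fm t| < eta.
  move=> hy; have k1 := hd0 s y (lt_le_trans h1 d1d0) (lt_le_trans hy d1d0).
  by move: k1 hIs; rewrite /fm !ltr_norml ler_norml; lra.
by split; [exact: lt_le_trans h2 d1e|exact: close|exact: close|exact: close].
Qed.

Lemma balance_right (t eta : R) : 0 <= t < T -> 0 < eta ->
  exists2 d : R, 0 < d <= T - t & forall s, t < s < t + d ->
    [/\ `|u s - up t| < eta, `|f s (u s) - I s - fp t| < eta,
        `|fm s - fp t| < eta & `|fp s - fp t| < eta].
Proof.
move=> tT eta0; have [K K0 hK] := primitive_lipschitz.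
have eta2 : 0 < eta / 2 by lra.
have [d0 d00 hd0] := continuous2_dist cf t (up t) eta2.
pose d1 := Num.min d0 (Num.min eta (eta / 2 / K)).
have d10 : 0 < d1 by rewrite !lt_min d00 eta0 /= divr_gt0.
have d1d0 : d1 <= d0 by rewrite ge_min lexx.
have d1e : d1 <= eta by rewrite /d1 !ge_min lexx orbT.
have d1K : d1 <= eta / 2 / K by rewrite /d1 !ge_min lexx !orbT.
have [d d2 hd] := right_close tT d10; exists d => // s hs.
have [h1 h2 h3 h4] := hd s hs.
have hIs : `|I s - I t| <= eta / 2.
  apply: le_trans (hK s t _ _) _; [case/andP: d2; lra|lra|].
  by rewrite mulrC -ler_pdivlMr//; apply: le_trans (ltW h1) d1K.
have close y : `|y - up t| < d1 -> `|f s y - I s - fp t| < eta.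
  move=> hy; have k1 := hd0 s y (lt_le_trans h1 d1d0) (lt_le_trans hy d1d0).
  by move: k1 hIs; rewrite /fp !ltr_norml ler_norml; lra.
by split; [exact: lt_le_trans h2 d1e|exact: close|exact: close|exact: close].
Qed.

(** For [t = 0] the approximating point is 0 itself, by the convention on [um 0]; with its mirror
    image at [T], this spares the later arguments a case distinction at the endpoints. *)
Lemma approx_left (t eta : R) : 0 <= t <= T -> 0 < eta -> exists s,
  [/\ 0 <= s, s <= t, t - s < eta, `|u s - um t| < eta & fm s <= fm t + eta].
Proof.
move=> /andP[t0 tT] eta0; have [t00|t_neq0] := eqVneq t 0.
  by exists 0; rewrite t00 hum0 !subrr normr0; split => //; lra.
have {}t0 : 0 < t by rewrite lt_def t_neq0.
have ht : 0 < t <= T by rewrite t0.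
have [d /andP[d0 dt] hd] := balance_left ht eta0.
pose r := Num.min d eta; exists (t - r / 2).
have r0 : 0 < r by rewrite lt_min d0.
have rd : r <= d by rewrite ge_min lexx.
have re : r <= eta by rewrite ge_min lexx orbT.
have [|h1 _ h3 _] := hd (t - r / 2); first by lra.
by split => //; [lra|lra|lra|move: h3; rewrite ltr_norml; lra].
Qed.

Lemma approx_right (t eta : R) : 0 <= t <= T -> 0 < eta -> exists s,
  [/\ t <= s, s <= T, s - t < eta, `|u s - up t| < eta & fp t - eta <= f s (u s) - I s].
Proof.
move=> /andP[t0 tT] eta0; have [tET|t_neqT] := eqVneq t T.
  by exists T; rewrite tET /fp hupT !subrr normr0; split => //; lra.
have {}tT : t < T by rewrite lt_def eq_sym t_neqT.
have ht : 0 <= t < T by rewrite t0.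
have [d /andP[d0 dt] hd] := balance_right ht eta0.
pose r := Num.min d eta; exists (t + r / 2).
have r0 : 0 < r by rewrite lt_min d0.
have rd : r <= d by rewrite ge_min lexx.
have re : r <= eta by rewrite ge_min lexx orbT.
have [|h1 h3 _ _] := hd (t + r / 2); first by lra.
by split => //; [lra|lra|lra|move: h3; rewrite ltr_norml; lra].
Qed.

Lemma balance_plus_le (t : R) : 0 <= t <= T -> fp t <= fm t.
Proof.
move=> ht; apply/ler_addgt0Pr => eta eta0; have eta2 : 0 < eta / 2 by lra.
have [s [s0 st _ _ hs]] := approx_left ht eta2.
have [r [tr rT _ _ hr]] := approx_right ht eta2.
by have := balance_le s0 (le_trans st tr) rT; lra.
Qed.

Lemma balance_nincr (r t : R) : 0 <= r -> r < t -> t <= T -> fm t <= fp r.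
Proof.
move=> r0 rt tT; apply/ler_addgt0Pr => eta eta0; have eta2 : 0 < eta / 2 by lra.
have ht : 0 < t <= T by lra.
have hr : 0 <= r < T by lra.
have [d /andP[d0 dt] hd] := balance_left ht eta2.
have [d' /andP[d'0 d't] hd'] := balance_right hr eta2.
pose s := Num.max (t - d / 2) ((r + t) / 2).
pose s' := Num.min (r + d' / 2) ((r + t) / 2).
have s's : s' <= s.
  apply: (@le_trans _ _ ((r + t) / 2)).
    by rewrite /s' ge_min lexx orbT.
  by rewrite /s le_max lexx orbT.
have [|_ h1 _ _] := hd s.
  by rewrite /s lt_max gt_max; lra.
have [|_ _ h2 _] := hd' s'.
  by rewrite /s' lt_min gt_min; lra.
have s'0 : 0 <= s' by rewrite /s' le_min; lra.
have sT : s <= T by rewrite /s ge_max; lra.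
have := balance_le s'0 s's sT.
by move: h1 h2; rewrite !ltr_norml; lra.
Qed.

(* The slope condition makes [f t] at the nearby critical points [up s] of [f s]
   drop by at most [o(|g t (up s)|) = o(s - t)]. *)
Lemma balance_right_derivative (t eta : R) : 0 <= t < T -> 0 < eta ->
  exists2 d : R, 0 < d & forall s, t < s < t + d -> s < T ->
    fp t - eta * (s - t) <= fp s.
Proof.
move=> tT eta0.
have tT' : 0 <= t <= T by lra.
have gt0 := critical_one_sided.1 t tT.
have [L [rho [L0 rho0 hL]]] := hlip (up t).
(* The three thirds go to the slope condition, to the time increment of [f] at the fixed point
   [up s], and to the increment of [I]. In the slope condition the third is divided by [L + 1],
   which is positive even when [L = 0]. *)
have eta3 : 0 < eta / 3 by lra.
have L1 : 0 < L + 1 by lra.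
have eta3L : 0 < eta / 3 / (L + 1) by rewrite divr_gt0.
have [rho2 rho20 hrho2] := hslope tT' gt0 eta3L.
have [d0 d00 hd0] := continuous2_dist cft t (up t) eta3.
pose d1 := Num.min d0 (Num.min rho rho2).
have d10 : 0 < d1 by rewrite !lt_min d00 rho0.
have d1d0 : d1 <= d0 by rewrite ge_min lexx.
have d1r : d1 <= rho by rewrite /d1 !ge_min lexx orbT.
have d1r2 : d1 <= rho2 by rewrite /d1 !ge_min lexx !orbT.
have [d /andP[d2 dT] hd] := right_close tT d10; exists d => // s hs sT.
have [h1 h2 h3 h4] := hd s hs; case/andP: hs => ts sd.
have hs : 0 <= s < T by lra.
have gs0 := critical_one_sided.1 s hs.
set y := up s in h4 gs0 *.
have k1 : - (eta / 3 * (s - t)) <= f t y - f t (up t).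
  apply: le_trans (hrho2 y (lt_le_trans h4 d1r2)); rewrite lerN2.
  have -> : `|g t y| = `|g t y - g s y| by rewrite gs0 subr0.
  have := hL y (lt_le_trans h4 d1r) t s tT' _.
  rewrite (distrC t) (gtr0_norm (x := s - t)) ?subr_gt0// => H.
  have {}H : `|g t y - g s y| <= L * (s - t) by apply: H; lra.
  apply: (@le_trans _ _ (eta / 3 / (L + 1) * ((L + 1) * (s - t)))).
    apply: ler_wpM2l; first exact: ltW.
    apply: le_trans H _; apply: ler_wpM2r; lra.
  by rewrite mulrA divfK// gt_eqF.
have k2 : (ft t (up t) - eta / 3) * (s - t) <= f s y - f t y.
  have [|c /andP[tc cs] ->] := derive_increment ts (continuous_slice (x := y) cf) (df := ft ^~ y).
    by move=> x /andP[tx xs]; apply: hft; lra.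
  apply: ler_wpM2r; first by lra.
  have ct : `|c - t| < d0.
    have := lt_le_trans h1 d1d0; rewrite !gtr0_norm; lra.
  by have := hd0 c y ct (lt_le_trans h4 d1d0); rewrite ltr_norml; lra.
have k3 : I s - I t <= (ft t (up t) + eta / 3) * (s - t).
  have t0 : 0 <= t by lra.
  have [H _] := hI (ft t (up t) + eta / 3) t0 (ltW ts) (ltW sT).
  apply: H => r /andP[tr rs]; have [|m1 m2 _ _] := hd r; first by lra.
  by have := hd0 r (u r) (lt_le_trans m1 d1d0) (lt_le_trans m2 d1d0); rewrite ltr_norml; lra.
by rewrite /fp -/y; lra.
Qed.

(** Only [x] has to be critical, and the trajectory may run either way between [x] and [y]: a jump
    at a positive time is centred at its left limit, a jump at 0 at its right limit. The constants
    are independent of [k]. *)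
Lemma jump_cost (t : R) (x y : X) : 0 <= t <= T -> g t x = 0 -> x != y ->
  exists D d : R, [/\ 0 < D, 0 < d & forall k (s1 s2 : R), e k < d -> 0 <= s1 ->
    s1 <= s2 -> s2 <= T -> `|s1 - t| < d -> `|s2 - t| < d ->
    (`|v k s1 - x| < d /\ `|v k s2 - y| < d) \/
    (`|v k s1 - y| < d /\ `|v k s2 - x| < d) -> D <= Q k s1 - Q k s2].
Proof.
move=> tT gx xy.
have [aA aA0 haA] := euclidean_linear_bounded hX A.
have [aB aB0 haB] := euclidean_linear_bounded hX B.
have [b b0 hb] := sym_posdef_coercive hX hB.
have xy0 : 0 < `|y - x| by rewrite normr_gt0 subr_eq0 eq_sym.
have [rho1 rho10 hrho1] := hiso tT gx.
(* Small enough that [x] is the only critical point in the closed ball and that points near [y] lie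
   outside the sphere [S]. *)
pose rho := Num.min rho1 (`|y - x| / 2).
have rho0 : 0 < rho by rewrite lt_min rho10 divr_gt0.
have rr1 : rho <= rho1 by rewrite ge_min lexx.
have rxy : rho <= `|y - x| / 2 by rewrite ge_min lexx orbT.
pose S := [set z : X | `|z - x| = rho].
have cS : compact S.
  apply: (subclosed_compact _ (closed_ball_compact hX (r := `|x| + rho))).
    apply: (@preimage_closed _ _ (fun z : X => `|z - x|) [set rho]) => //.
    move=> z _; apply: cvg_norm; apply: cvgB; [exact: cvg_id|exact: cvg_cst].
  by move=> z /= Sz; rewrite -(subrK x z) (le_trans (ler_normD _ _))// Sz addrC.
have cgt : continuous (g t) by exact: continuous_section.
have [c3 c30 hc3] : exists2 c : R, 0 < c & forall z, S z -> c <= `|g t z|.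
  apply: compact_lower_bound => //.
    by move=> z; apply: cvg_norm; exact: cgt.
  move=> z Sz; rewrite normr_gt0; apply: hrho1; rewrite Sz rho0 /=.
  exact: rr1.
pose c := c3 / 3; have c0 : 0 < c by rewrite divr_gt0.
(* Near-covering compactness makes the modulus of continuity of [g] at time [t] uniform over the
   sphere. *)
have [d1 d10 hd1] : exists2 d : R, 0 < d & forall z, S z -> forall (s : R) z',
    `|s - t| < d -> `|z' - z| < d -> `|g s z' - g t z| <= c.
  move/compact_near_coveringP : cS => cS.
  have := cS R (0 : R)^'+ (fun d z => forall (s : R) z',
    `|s - t| < d -> `|z' - z| < d -> `|g s z' - g t z| <= c) _.
  move=> H; have {H}: \forall d \near (0 : R)^'+, S `<=` (fun z => forall (s : R) z',
    `|s - t| < d -> `|z' - z| < d -> `|g s z' - g t z| <= c).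
    apply: H => z Sz.
    have c2 : 0 < c / 2 by rewrite divr_gt0.
    have [d d0 hd] := continuous2_dist cg t z c2.
    have d2 : 0 < d / 2 by rewrite divr_gt0.
    exists ([set z' | `|z' - z| < d / 2], [set i | i < d / 2]) => /=.
      split; last by apply: nbhs_right_lt.
      by apply/nbhs_ballP; exists (d / 2) => //= z'; rewrite -ball_normE /= distrC.
    move=> [z' i] [/= h1 h2] s z'' hs hz.
    have k1 : `|g s z'' - g t z| < c / 2.
      apply: hd; first by lra.
      by apply: le_lt_trans (ler_distD z' _ _) _; lra.
    have k2 : `|g t z' - g t z| < c / 2.
      by apply: hd; [rewrite subrr normr0|lra].
    by apply: le_trans (ler_distD (g t z) _ _) _; rewrite (distrC (g t z)); lra.
  move=> H; near (0 : R)^'+ => d; exists d; first by near: d; exact: nbhs_right_gt.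
  by near: d; exact: H.
pose L := 3 * (4 * aA + aB).
have L0 : 0 < L by rewrite mulr_gt0// addr_gt0// mulr_gt0.
(* The first bound keeps the window around the crossing time where [g] varies by at most [c]; the
   second excludes a passage shorter than [e k]; the third makes [gradient_le] give at most [2 * c]
   on the sphere, where the gradient is at least [c3 = 3 * c]. *)
pose eta := Num.min (d1 / 2) (Num.min (rho / 4) (c / L)).
have eta0 : 0 < eta by rewrite !lt_min !divr_gt0.
have ed1 : eta <= d1 / 2 by rewrite ge_min lexx.
have er : eta <= rho / 4 by rewrite /eta !ge_min lexx orbT.
have eL : L * eta <= c.
  by rewrite mulrC -ler_pdivlMr// /eta !ge_min lexx !orbT.
exists (b * eta ^+ 2), (Num.min (d1 / 2) (rho / 4)); split.
- by rewrite mulr_gt0// exprn_gt0.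
- by rewrite lt_min !divr_gt0.
move=> k s1 s2; rewrite !lt_min => /andP[ed er'] s10 s12 s2T /andP[s1t _] /andP[s2t _] hxy.
rewrite leNgt; apply/negP => /ltW cost.
have disp (r r' : R) : s1 <= r -> r <= r' -> r' <= s2 -> r' - r <= e k ->
    `|v k r' - v k r| <= eta.
  move=> r1 r12 r2 r'r.
  apply: (displacement_le hX hA cf cft hft hfx hfg (@e_gt0 k) (@cv k) (@cw k) (@hv k) (@hw k)
    (@ode k) (@cP k) (@dP k) b0 hb) => //; [lra|lra|].
  apply: le_trans cost.
  have q1 : Q k r <= Q k s1 by apply: Q_nincr; lra.
  have q2 : Q k s2 <= Q k r' by apply: Q_nincr; lra.
  by move: q1 q2; rewrite /Q; lra.
have {}hxy : (`|v k s1 - x| < rho / 4 /\ `|v k s2 - y| < rho / 4) \/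
             (`|v k s1 - y| < rho / 4 /\ `|v k s2 - x| < rho / 4).
  by case: hxy => -[/andP[_ h1] /andP[_ h2]]; [left|right].
have far z : `|z - y| < rho / 4 -> rho < `|z - x|.
  move=> hz; have : `|y - x| <= `|z - x| + `|z - y|.
    by apply: le_trans (ler_distD z _ _) _; rewrite (distrC y) addrC.
  lra.
have [short|long] := ltP (s2 - s1) (e k).
  have := disp s1 s2 (lexx _) s12 (lexx _) (ltW short) => hd.
  have tri : `|y - x| < rho.
    case: hxy => -[h1 h2].
    - have k1 := ler_distD (v k s2) y x; rewrite (distrC y (v k s2)) in k1.
      by have k2 := ler_distD (v k s1) (v k s2) x; lra.
    - have k1 := ler_distD (v k s1) y x; rewrite (distrC y (v k s1)) in k1.
      have k2 := ler_distD (v k s2) (v k s1) x.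
      by rewrite (distrC (v k s1) (v k s2)) in k2; lra.
  lra.
have [r r12 hr] : exists2 r, r \in `[s1, s2] & `|v k r - x| = rho.
  apply: (IVT (f := fun r => `|v k r - x|) s12).
    apply: continuous_subspaceT => r; apply: cvg_norm.
    by apply: cvgB; [exact: cv|exact: cvg_cst].
  rewrite ge_min le_max.
  by case: hxy => -[h1 h2]; [have := far _ h2|have := far _ h1]; lra.
rewrite in_itv /= in r12.
have := gradient_le hX hA cf cft hft hfx hfg (@e_gt0 k) (@cv k) (@cw k) (@hv k) (@hw k)
    (@ode k) (@cP k) (@dP k) b0 hb aA0 haA aB0 haB (G0 := g t (v k r)) (om := c)
    s10 s2T long r12 eta0 cost.
have -> : 3 * (4 * aA + aB) * eta = L * eta by [].
have := hc3 _ hr; have c3E : c3 = 3 * c by rewrite /c; lra.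
move=> hG H; suff : `|g t (v k r)| <= c + L * eta by lra.
apply: H => z sz zr; apply: hd1 => //.
  by case/andP: sz; move: s1t s2t; rewrite !ltr_norml; lra.
apply: (@le_lt_trans _ _ eta); last by lra.
case/andP: sz => z1 z2; case/andP: r12 => r1 r2; move: zr; rewrite ler_norml => zr.
have [rz|zr'] := leP r z; first by apply: disp => //; lra.
by rewrite distrC; apply: disp => //; lra.
Unshelve. all: by end_near. Qed.

Lemma balance_jump (t : R) : 0 <= t <= T -> um t <> up t -> fp t < fm t.
Proof.
move=> ht jump.
have [D [d [D0 d0 hD]]] : exists D d : R, [/\ 0 < D, 0 < d &
    forall k (s1 s2 : R), e k < d -> 0 <= s1 -> s1 <= s2 -> s2 <= T ->
    `|s1 - t| < d -> `|s2 - t| < d ->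
    `|v k s1 - um t| < d -> `|v k s2 - up t| < d -> D <= Q k s1 - Q k s2].
  have [t0|t0] := ltP 0 t.
  - have gm : g t (um t) = 0 by apply: critical_one_sided.2; lra.
    have [D [d [D0 d0 hD]]] := jump_cost ht gm (introN eqP jump).
    by exists D, d; split => // *; apply: hD => //; left.
  - have gp : g t (up t) = 0 by apply: critical_one_sided.1; have := T0; lra.
    have [D [d [D0 d0 hD]]] := jump_cost ht gp (introN eqP (nesym jump)).
    by exists D, d; split => // *; apply: hD => //; right.
(* Moving to the approximating points loses at most [D / 4] on each side, so a drop of [D / 2]
   remains at [t]. *)
pose eta := Num.min (d / 2) (D / 4).
have eta0 : 0 < eta by rewrite lt_min !divr_gt0.
have ed : eta <= d / 2 by rewrite ge_min lexx.
have eD : eta <= D / 4 by rewrite ge_min lexx orbT.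
have [s1 [s10 s1t ts1 us1 fs1]] := approx_left ht eta0.
have [s2 [ts2 s2T s2t us2 fs2]] := approx_right ht eta0.
have d2 : 0 < d / 2 by lra.
have hs1 : 0 <= s1 <= T by lra.
have hs2 : 0 <= s2 <= T by lra.
have n1 : \forall k \near \oo, `|u s1 - v k s1| < d / 2.
  by apply: cvgr_dist_lt => //; exact: hu.
have n2 : \forall k \near \oo, `|u s2 - v k s2| < d / 2.
  by apply: cvgr_dist_lt => //; exact: hu.
have n3 : \forall k \near \oo, e k < d by apply: cvgr_lt e_cvg0 _ d0.
suff gap : f s2 (u s2) - I s2 + D <= fm s1 by lra.
apply: balance_le_gap => //; first exact: le_trans s1t ts2.
near=> k; apply: hD => //.
- by near: k.
- exact: le_trans s1t ts2.
- by rewrite ler0_norm ?subr_le0//; lra.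
- by rewrite ger0_norm ?subr_ge0//; lra.
- have : `|u s1 - v k s1| < d / 2 by near: k.
  rewrite distrC => h; apply: le_lt_trans (ler_distD (u s1) _ _) _; lra.
- have : `|u s2 - v k s2| < d / 2 by near: k.
  rewrite distrC => h; apply: le_lt_trans (ler_distD (u s2) _ _) _; lra.
Unshelve. all: by end_near. Qed.

End energy_limit.

End vanishing_inertia.

(** * The measure carried by the jumps *)

Section point_mass.
Context {R : realType}.
Variable a : R -> R.
Hypothesis a_ge0 : forall x, 0 <= a x.
Local Open Scope ereal_scope.

(* The unused argument [ha] lets the measure structure be inferred from the term. *)
Definition point_mass (ha : forall x, (0 <= a x)%R) (S : set (measurableTypeR R)) : \bar R :=
  \esum_(x in S) (a x)%:E.

Let mu := point_mass a_ge0.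

Let mu0 : mu set0 = 0. Proof. exact: esum_set0. Qed.

Let mu_ge0 S : 0 <= mu S.
Proof. by apply: esum_ge0 => x _; rewrite lee_fin. Qed.

Let mu_sigma_additive : semi_sigma_additive mu.
Proof.
move=> F mF tF mUF; rewrite /mu /point_mass esum_bigcupT//.
rewrite -nneseries_esumT//; last by move=> k; exact: mu_ge0.
by apply: is_cvg_nneseries => k _ _; exact: mu_ge0.
Qed.

HB.instance Definition _ := isMeasure.Build _ _ _ (point_mass a_ge0)
  mu0 mu_ge0 mu_sigma_additive.

Lemma point_mass_set1 x : point_mass a_ge0 [set x] = (a x)%:E.
Proof. by rewrite /point_mass esum_set1// lee_fin. Qed.

End point_mass.

Section jump_measure.
Context {R : realType}.
Variables (T : R) (fm fp : R -> R).
Hypothesis fpm : forall t : R, 0 <= t <= T -> fp t <= fm t.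
Hypothesis fmp : forall r t : R, 0 <= r -> r < t -> t <= T -> fm t <= fp r.
Hypothesis fright : forall t eta : R, 0 <= t < T -> 0 < eta ->
  exists2 d : R, 0 < d & forall s, t < s < t + d -> s < T ->
    fp t - eta * (s - t) <= fp s.
Hypothesis fleft : forall t eta : R, 0 < t <= T -> 0 < eta ->
  exists2 d : R, 0 < d <= t & forall s, t - d < s < t -> `|fp s - fm t| < eta.

Lemma fm_nincr (r t : R) : 0 <= r -> r <= t -> t <= T -> fm t <= fm r.
Proof.
move=> r0; rewrite le_eqVlt => /orP[/eqP ->//|rt] tT.
by apply: le_trans (fmp r0 rt tT) (fpm _); lra.
Qed.

Lemma fp_nincr (r t : R) : 0 <= r -> r <= t -> t <= T -> fp t <= fp r.
Proof.
move=> r0; rewrite le_eqVlt => /orP[/eqP ->//|rt] tT.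
by apply: le_trans (fpm _) (fmp r0 rt tT); lra.
Qed.

(** The sum telescopes up to sign: for consecutive points [x < y] of the list, [fm y <= fp x]. *)
Lemma sum_jumps_le (l : seq R) (s t : R) : 0 <= s -> s <= t -> t <= T ->
  sorted <%R l -> (forall x, x \in l -> s <= x <= t) ->
  \sum_(x <- l) (fm x - fp x) <= fm s - fp t.
Proof.
move=> + + tT; elim: l s => [|x l IH] s s0 st.
  move=> _ _; rewrite big_nil subr_ge0.
  by apply: le_trans (fpm _) (fm_nincr s0 st tT); lra.
rewrite /= => sl hl; rewrite big_cons.
have /andP[sx xt] : s <= x <= t by apply: hl; rewrite mem_head.
have h1 : fm x <= fm s by apply: fm_nincr; lra.
case: l IH sl hl => [|y l] IH sl hl.
  rewrite big_nil; have h2 : fp t <= fp x by apply: fp_nincr; lra.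
  lra.
have /andP[sy yt] : s <= y <= t by apply: hl; rewrite !inE eqxx orbT.
move: sl => /= /andP[xy sl].
have h2 : fm y <= fp x by apply: fmp => //; lra.
have h3 : \sum_(x <- y :: l) (fm x - fp x) <= fm y - fp t.
  apply: IH => //; first by lra.
  move=> z zl; have /andP[_ ->] : s <= z <= t by apply: hl; rewrite inE zl orbT.
  rewrite andbT; move: zl; rewrite inE => /orP[/eqP ->//|zl].
  have := order_path_min lt_trans sl.
  by move=> /allP/(_ z zl)/ltW.
lra.
Qed.

Let a (x : R) := if 0 <= x <= T then fm x - fp x else 0.

Let a_ge0 x : 0 <= a x.
Proof. by rewrite /a; case: ifP => // h; rewrite subr_ge0 fpm. Qed.

Let mu : {measure set (measurableTypeR R) -> \bar R} := point_mass a_ge0.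

Let mu_le (s t : R) : 0 <= s -> s <= t -> t <= T ->
  (mu `[s, t]%classic <= (fm s - fp t)%:E)%E.
Proof.
move=> s0 st tT; apply: ge_ereal_sup => _ [F [finF subF] <-].
rewrite fsbig_finite//= sumEFin lee_fin.
rewrite (perm_big (sort <=%R (finmap.enum_fset (fset_set F)))) /=; last first.
  by rewrite perm_sym perm_sort.
have hF x : x \in sort <=%R (finmap.enum_fset (fset_set F)) -> s <= x <= t.
  rewrite mem_sort in_fset_set// inE => /subF /=.
  by rewrite in_itv.
rewrite (eq_big_seq (fun x => fm x - fp x)); last first.
  move=> x /hF hx; rewrite /a ifT//; lra.
apply: sum_jumps_le => //.
rewrite lt_sorted_uniq_le sort_uniq finmap.fset_uniq /=.
exact: sort_le_sorted.
Qed.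

(** The mass of an interval is at most the decrease, by telescoping finite sums. The converse
    excludes a continuous part of the decrease and rests on the right derivative. *)
Lemma jump_measureP : exists mu : {measure set (measurableTypeR R) -> \bar R},
  [/\ atomic mu, atoms mu = [set t | 0 <= t <= T /\ fp t < fm t] &
    forall s t : R, 0 <= s -> s <= t -> t <= T ->
      mu `[s, t]%classic = (fm s - fp t)%:E].
Proof.
exists mu.
have mu1 x : mu [set x] = (a x)%:E by exact: point_mass_set1.
have atomsE : atoms mu = [set t | 0 <= t <= T /\ fp t < fm t].
  apply/seteqP; split=> x; rewrite /atoms /= mu1 lte_fin /a.
    by case: ifP => [h|]; rewrite ?ltxx// subr_gt0.
  by move=> [-> h]; rewrite subr_gt0.
have muE (s t : R) : 0 <= s -> s <= t -> t <= T ->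
    mu `[s, t]%classic = (fm s - fp t)%:E.
  move=> s0 st tT.
  pose N (r : R) := fine (mu `[s, r]%classic).
  have NE (r : R) : s <= r <= t -> mu `[s, r]%classic = (N r)%:E.
    move=> /andP[sr rt]; rewrite /N fineK// ge0_fin_numE//.
    by apply: le_lt_trans (mu_le s0 sr (le_trans rt tT)) _; exact: ltry.
  have Nmono (r r' : R) : s <= r -> r <= r' -> r' <= t -> N r <= N r'.
    move=> sr rr' r't; rewrite -lee_fin -!NE ?sr ?(le_trans sr rr')//; last first.
      exact: le_trans rr' r't.
    apply: le_measure; rewrite ?inE//.
    by apply: subset_itv; rewrite bnd_simp.
  have Natom (r r' : R) : s <= r -> r < r' -> r' <= t -> N r + a r' <= N r'.
    move=> sr rr' r't; have sr' := le_trans sr (ltW rr').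
    rewrite -lee_fin EFinD -!NE ?sr ?sr'//; last exact: le_trans (ltW rr') r't.
    rewrite -mu1 -measureU//; last first.
      apply/seteqP; split=> // x [/= + xr']; rewrite xr' in_itv /= => /andP[_].
      by rewrite leNgt rr'.
    apply: le_measure; rewrite ?inE//; first exact: measurableU.
    move=> x [/=|/= ->]; rewrite !in_itv /=; last by rewrite sr' lexx.
    by case/andP => -> h /=; exact: le_trans h (ltW rr').
  apply/eqP; rewrite eq_le mu_le//= NE ?lexx ?st// lee_fin.
  suff H eta : 0 < eta -> fm s - fp t <= N t + eta * (t - s).
    apply/ler_addgt0Pr => eta eta0.
    have h : 0 < eta / (t - s + 1) by rewrite divr_gt0//; lra.
    apply: le_trans (H _ h) _; rewrite lerD2l mulrAC ler_pdivrMr; last by lra.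
    by apply: ler_wpM2l; lra.
  move=> eta0.
  (* The slack [eta * (r - s)] absorbs the [o(r' - r)] loss of each step to the right; [eta] is
     arbitrary. *)
  apply: (@real_induction _ s t (fun r => fm s - fp r <= N r + eta * (r - s))) => //.
  - rewrite subrr mulr0 addr0 /N set_itv1 mu1 /= /a ifT//.
    by rewrite s0 (le_trans st tT).
  - move=> r /andP[sr rt] Hr; have hr : 0 <= r < T by lra.
    have [d d0 hd] := fright hr eta0; exists d => // r' /andP[rr' r'd] r't.
    have k1 := hd r' (introT andP (conj rr' r'd)) (lt_le_trans r't tT).
    have k2 := Nmono r r' sr (ltW rr') (ltW r't).
    lra.
  (* Just before [r] the value of [fp] is within [kap] of [fm r], and the atom at [r] supplies
     exactly the remaining drop from [fm r] to [fp r]. *)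
  - move=> r /andP[sr rt] Hr; apply/ler_addgt0Pr => kap kap0.
    have hr : 0 < r <= T by lra.
    have [d /andP[d0 dr] hd] := fleft hr kap0.
    pose r' := Num.max ((s + r) / 2) (r - d / 2).
    have sr' : s <= r' by rewrite le_max; apply/orP; left; lra.
    have r'r : r' < r by rewrite gt_max; lra.
    have dr' : r - d < r' by rewrite lt_max; apply/orP; right; lra.
    have k1 := hd r' (introT andP (conj dr' r'r)).
    have k2 := Natom r' r sr' r'r rt.
    have k3 := Hr r' (introT andP (conj sr' r'r)).
    have k4 : a r = fm r - fp r by rewrite /a ifT//; lra.
    have k5 : eta * (r' - s) <= eta * (r - s) by apply: ler_wpM2l; lra.
    by move: k1; rewrite ltr_norml k4 in k2 *; lra.
split=> //; rewrite /atomic.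
have cJ : countable (atoms mu).
  (* A rational in each gap between [fp t] and [fm t]; these gaps are disjoint and ordered by
     monotonicity, so [q] is injective on the atoms. *)
  pose q (t : R) : rat :=
    if pselect (exists q : rat, fp t < ratr q < fm t) is left h then projT1 (cid h) else 0.
  have qP (t : R) : atoms mu t -> fp t < ratr (q t) < fm t.
    rewrite atomsE => -[_ ft]; rewrite /q; case: pselect => [h|].
      exact: projT2 (cid h).
    case; have [x] := rat_in_itvoo ft; rewrite in_itv /= => hx; by exists x.
  have q_lt (r t : R) : atoms mu r -> atoms mu t -> r < t -> q t < q r.
    move=> hr ht rt; rewrite -(ltr_rat R).
    have /andP[h1 _] := qP _ hr; have /andP[_ h2] := qP _ ht.
    move: hr ht; rewrite atomsE => -[/andP[r0 _] _] [/andP[_ tT] _].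
    exact: lt_trans (lt_le_trans h2 (fmp r0 rt tT)) h1.
  have qinj : {in atoms mu &, injective q}.
    move=> r t; rewrite !inE => hr ht E.
    have [rt|tr|//] := ltgtP r t.
      by have := q_lt _ _ hr ht rt; rewrite E ltxx.
    by have := q_lt _ _ ht hr tr; rewrite E ltxx.
  rewrite -(eq_countable (inj_card_eq qinj)); exact: countableP.
exists (~` atoms mu); split => //.
  by apply: measurableC; apply: countable_measurable.
rewrite /mu /= /point_mass esum1// => x /= nx; congr (_%:E); apply/eqP.
rewrite eq_le a_ge0 andbT leNgt; apply/negP => ax; apply: nx.
by rewrite /atoms /= mu1 lte_fin.
Qed.

End jump_measure.

(** * The assumptions in clamped time *)

Section assumptions_clamped.
Context {R : realType} {X : normedModType R} {ip : X -> X -> R} {n : nat}.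
Hypothesis hX : euclidean ip n.
Variables (T : R) (F : R -> X -> R).
Hypothesis T0 : 0 < T.

Let f (t : R) x := F (clamp T t) x.
Let ft (t : R) x := dtF T F (clamp T t) x.
Let g (t : R) x := gradF ip F (clamp T t) x.

Let clamp_itv (t : R) : clamp T t \in `[0, T].
Proof. exact/clamp_in/ltW. Qed.

Let itv_le (t : R) : t \in `[0, T] = (0 <= t <= T).
Proof. by rewrite in_itv. Qed.

Lemma continuous_clamp_cylinder {Z : topologicalType} (h : R * X -> Z) :
  {within cylinder T, continuous h} ->
  continuous (fun p : R * X => h (clamp T p.1, p.2)).
Proof.
move=> ch; apply: (@continuous_within_comp _ _ _ (cylinder T) h
  (fun p : R * X => (clamp T p.1, p.2))) => //.
  move=> p; apply: (@cvg_pair _ _ _ (nbhs p) (nbhs (clamp T p.1)) (nbhs p.2)).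
    apply: (@continuous_comp _ _ _ (fst : R * X -> R) (clamp T)).
      exact: cvg_fst.
    exact: clamp_continuous.
  exact: cvg_snd.
by move=> p; split => //=; rewrite -itv_le.
Qed.

Lemma is_derive_clamped (h : R -> R) (s : R) : 0 < s < T ->
  derivable_within `[0, T]%classic h s ->
  is_derive s 1 (fun t => h (clamp T t)) (derive_within `[0, T]%classic h s).
Proof.
move=> sT dh; apply: (@is_derive_near_eq _ _ h); last exact: is_derive_within.
by apply: filterS (clamp_near sT) => t ->.
Qed.

Lemma lipschitz_clamped : F3' ip T F -> forall x, exists L rho : R,
  [/\ 0 <= L, 0 < rho & forall y, `|y - x| < rho ->
    forall s t : R, 0 <= s <= T -> 0 <= t <= T -> `|g s y - g t y| <= L * `|s - t|].
Proof.
move=> h3 x; have [L /nbhs_ballP[rho rho0 hL]] := h3 x.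
(* The constant in (F3') comes without a sign. *)
exists `|L|, rho; split => // y yx s t sT tT.
have xy : ball x rho y by rewrite -ball_normE /= distrC.
have := hL y xy; rewrite /lipschitz_on /= => /(_ (s, t)).
rewrite /g /= !clampE// => H; apply: le_trans (H _) _.
  by split; rewrite /= in_itv.
by apply: ler_wpM2r => //; exact: ler_norm.
Qed.

Lemma isolated_clamped : F5 ip T F -> forall (t : R) x, 0 <= t <= T -> g t x = 0 ->
  exists2 rho : R, 0 < rho & forall y, 0 < `|y - x| <= rho -> g t y != 0.
Proof.
move=> h5 t x tT gx; rewrite -itv_le in tT.
have cx : crit ip F t x by move: gx; rewrite /g clampE// -itv_le.
have [_ [V Vx VE]] := h5 t tT x cx.
move/nbhs_ballP : Vx => [rho rho0 hV].
exists (rho / 2); first by rewrite divr_gt0.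
move=> y /andP[yx0 yx]; apply/eqP => gy.
have cy : crit ip F t y by move: gy; rewrite /g clampE// -itv_le.
have : (V `&` crit ip F t) y.
  split => //; apply: hV; rewrite -ball_normE /= distrC.
  by apply: le_lt_trans yx _; rewrite ltr_pdivrMr// ltr_pMr// ltr1n.
by rewrite VE => /= yE; move: yx0; rewrite yE subrr normr0 ltxx.
Qed.

(** By (F5) the gradient is nonzero at every other point near [x], so the quotient in (F6) can be
    multiplied out; where the gradient vanishes the quotient is 0 by convention and carries no
    information. *)
Lemma slope_clamped : F5 ip T F -> F6 ip T F ->
  forall (t : R) x, 0 <= t <= T -> g t x = 0 ->
  forall eta : R, 0 < eta -> exists2 rho : R, 0 < rho &
  forall y, `|y - x| < rho -> - (eta * `|g t y|) <= f t y - f t x.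
Proof.
move=> h5 h6 t x tT gx eta eta0.
have [rho1 rho10 hrho1] := isolated_clamped h5 tT gx.
have tT' : t \in `[0, T] by rewrite itv_le.
have cx : crit ip F t x by move: gx; rewrite /g clampE.
have := h6 t x tT' cx; rewrite limf_einfE => hinf.
have : ((- eta)%:E < ereal_sup [set ereal_inf
    ((fun y => ((F t y - F t x) / `|gradF ip F t y|)%:E) @` V) | V in x^'])%E.
  by apply: lt_le_trans hinf; rewrite lte_fin oppr_lt0.
move=> /ereal_sup_gt[_ [V Vx <-] hV].
move: Vx; rewrite /dnbhs /within /= => /nbhs_ballP[rho2 rho20 hrho2].
exists (Num.min rho1 rho2); first by rewrite lt_min rho10.
move=> y; rewrite lt_min => /andP[y1 y2].
have [->|yx] := eqVneq y x; first by rewrite subrr oppr_le0 mulr_ge0// ltW.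
have gy : g t y != 0 by apply: hrho1; rewrite normr_gt0 subr_eq0 yx ltW.
have Vy : V y by apply: hrho2 => //; rewrite -ball_normE /= distrC.
have : ((- eta)%:E < ((F t y - F t x) / `|gradF ip F t y|)%:E)%E.
  by apply: lt_le_trans hV _; apply: ereal_inf_lbound; exists y.
rewrite lte_fin /f; move: gy; rewrite /g clampE// => gy.
by rewrite ltr_pdivlMr ?normr_gt0// mulNr => /ltW.
Qed.

End assumptions_clamped.

Lemma cvg_left_dist {R : realType} {X : normedModType R} (u : R -> X) (t eta : R) :
  cvg (u s @[s --> t^'-]) -> 0 < t -> 0 < eta -> exists2 d : R, 0 < d <= t &
    forall s, t - d < s < t -> `|u s - lim (u s @[s --> t^'-])| < eta.
Proof.
move=> cu t0 eta0; have /cvgrPdist_lt/(_ eta eta0) := cu.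
move=> [d /= d0 hd]; exists (Num.min d t); first by rewrite lt_min d0 t0 ge_min lexx orbT.
move=> s /andP[s1 s2]; rewrite distrC; apply: hd => //=.
have : Num.min d t <= d by rewrite ge_min lexx.
by rewrite gtr0_norm ?subr_gt0//; lra.
Qed.

Lemma cvg_right_dist {R : realType} {X : normedModType R} (u : R -> X) (T t eta : R) :
  cvg (u s @[s --> t^'+]) -> t < T -> 0 < eta -> exists2 d : R, 0 < d <= T - t &
    forall s, t < s < t + d -> `|u s - lim (u s @[s --> t^'+])| < eta.
Proof.
move=> cu tT eta0; have /cvgrPdist_lt/(_ eta eta0) := cu.
move=> [d /= d0 hd]; exists (Num.min d (T - t)).
  by rewrite lt_min d0 subr_gt0 tT ge_min lexx orbT.
move=> s /andP[s1 s2]; rewrite distrC; apply: hd => //=.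
have : Num.min d (T - t) <= d by rewrite ge_min lexx.
by rewrite ltr0_norm ?subr_lt0//; lra.
Qed.

Lemma derivable_within_clamp_continuous {R : realType} {X : normedModType R} (T : R)
    (h : R -> X) : 0 <= T ->
  (forall t : R, t \in `[0, T] -> derivable_within `[0, T]%classic h t) ->
  continuous (fun t => h (clamp T t)).
Proof.
move=> T0 dh; apply: (@continuous_within_comp _ _ _ `[0, T]%classic h (clamp T)).
- by apply/subspace_continuousP => t tT; apply: derivable_within_cvg => //; exact: dh.
- exact: clamp_continuous.
- by move=> t; exact: clamp_in.
Qed.

(** * A priori bounds uniform in [eps] *)

Section a_priori.
Context {R : realType} {X : normedModType R} {ip : X -> X -> R} {n : nat}.
Hypothesis hX : euclidean ip n.
Variables (T : R) (A B : {linear X -> X}) (f ft : R -> X -> R) (g : R -> X -> X).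
Hypothesis T0 : 0 < T.
Hypothesis hA : sym_posdef ip A.
Hypothesis hB : sym_posdef ip B.
Hypothesis cf : continuous (fun p : R * X => f p.1 p.2).
Hypothesis cft : continuous (fun p : R * X => ft p.1 p.2).
Hypothesis hft : forall (s : R) x, 0 < s < T -> is_derive s 1 (f ^~ x) (ft s x).
Hypothesis hfx : forall (t : R) x, 0 < t < T -> differentiable (f t) x.
Hypothesis hfg : forall (t : R) x y, 0 < t < T -> 'd (f t) x y = ip (g t x) y.
Variables C1 C2 : R.
Hypothesis C1gt0 : 0 < C1.
Hypothesis C2gt0 : 0 < C2.
Hypothesis hF2 : forall (t : R) x, 0 <= t <= T -> `|ft t x| <= C1 * f t x + C2.
Hypothesis hF1 : forall rho : R, 0 < rho -> exists M : R, forall x,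
  (forall t : R, 0 <= t <= T -> `|f t x| <= rho) -> `|x| <= M.

Lemma solution_bounded (M0 : R) : exists M W : R,
  forall (eps : R) (v w dw : R -> X), 0 < eps -> continuous v -> continuous w ->
  (forall t : R, 0 < t < T -> is_derive t 1 v (eps^-1 *: w t)) ->
  (forall t : R, 0 < t < T -> is_derive t 1 w (dw t)) ->
  (forall t : R, 0 < t < T -> eps *: A (dw t) + B (w t) + g t (v t) = 0) ->
  `|v 0| <= M0 -> `|w 0| <= 1 ->
  forall t : R, 0 <= t <= T -> `|v t| <= M /\ `|w t| <= W.
Proof.
have [aA aA0 haA] := euclidean_linear_bounded hX A.
have [b b0 hb] := sym_posdef_coercive hX hA.
have [bB bB0 hbB] := sym_posdef_coercive hX hB.
have posA x : 0 <= ip (A x) x by apply: le_trans (hb x); rewrite mulr_ge0// ltW.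
have posB x : 0 <= ip (B x) x by apply: le_trans (hbB x); rewrite mulr_ge0// ltW.
have [Kf Kf0 hKf] := bounded_on_cylinder hX T M0 cf.
pose c := C2 / C1; have c0 : 0 < c by rewrite divr_gt0.
pose E1 := expR (C1 * T) * (Kf + aA + c).
have E10 : 0 < E1 by rewrite mulr_gt0 ?expR_gt0// !addr_gt0.
pose E2 := expR (C1 * T) * E1.
have E20 : 0 < E2 by rewrite mulr_gt0 ?expR_gt0.
have [M hM] := hF1 (rho := E2 + c) (addr_gt0 E20 c0).
(* [E1] bounds the shifted energy and [E2] the shifted potential at all times. The bound on [w] uses
   [y <= y^2 + 1] in place of a square root. *)
exists M, (2 * E1 / b + 1) => eps v w dw eps0 cv cw hv hw ode v0 w0 t tT.
have h00 : 0 <= (0 : R) <= T by rewrite lexx ltW.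
have hE0 : energy (ip := ip) A f v w 0 <= Kf + aA.
  rewrite /energy lerD//; first by apply: le_trans (ler_norm _) _; exact: hKf.
  have h1 : ip (A (w 0)) (w 0) <= aA.
    apply: le_trans (ip_le hX _ _) _.
    rewrite -[leRHS]mulr1; apply: ler_pM => //.
    by apply: le_trans (haA _) _; rewrite ler_piMr// ltW.
  have h2 := posA (w 0); lra.
have hE := energy_le hX hA cf cft hft hfx hfg eps0 cv cw hv hw ode C1gt0 T0 hF2 posA posB tT.
have {}hE : energy (ip := ip) A f v w t + c <= E1.
  by apply: le_trans hE _; rewrite /E1 ler_pM2l ?expR_gt0// lerD2r.
have hpos (s : R) x : 0 <= s <= T -> 0 <= f s x + c.
  by move=> sT; exact: (potential_ge C1gt0 hF2).
have kin : 0 <= 2^-1 * ip (A (w t)) (w t) by rewrite mulr_ge0.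
split.
- apply: hM => s sT.
  have h1 := potential_le cf hft C1gt0 hF2 (v t) sT tT.
  have h2 : f s (v t) + c <= E2.
    apply: le_trans h1 _; rewrite /E2 ler_pM2l ?expR_gt0//.
    by move: hE kin; rewrite /energy /c; lra.
  have h3 := hpos s (v t) sT.
  by rewrite ler_norml; lra.
- have h1 : b * `|w t| ^+ 2 <= b * (2 * E1 / b).
    rewrite (mulrC _ (2 * E1 / b)) divfK ?gt_eqF//.
    by have := hb (w t); have := hpos t (v t) tT; move: hE; rewrite /energy; lra.
  rewrite ler_pM2l// in h1.
  have := sqr_ge0 (`|w t| - 1); have := normr_ge0 (w t).
  by move: h1; move: (2 * E1 / b) `|w t| => x y; nra.
Qed.

End a_priori.

(** * The family of solutions in clamped time *)

Unset Implicit Arguments.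

Theorem theorem5p4 (R : realType) (T : R) (hT : 0 < T)
    (n : nat) (hn : (1 <= n)%N)
    (X : normedModType R) (ip : X -> X -> R) (hX : euclidean ip n)
    (A B : {linear X -> X}) (hA : sym_posdef ip A) (hB : sym_posdef ip B)
    (F : R -> X -> R)
    (hF0 : F0 ip T F) (hF1 : F1 T F) (hF2 : F2 T F) (hF3 : F3' ip T F)
    (hF4 : F4 ip T F) (hF5 : F5 ip T F) (hF6 : F6 ip T F)
    (ueps : R -> R -> X)
    (hode : forall eps : R, 0 < eps ->
       second_order_solution ip T F A B eps (ueps eps))
    (hbnd : exists M : R, forall eps : R, 0 < eps -> `|ueps eps 0| <= M)
    (hvel : eps *: derive_within `[0, T] (ueps eps) 0 @[eps --> (0 : R)^'+]
              --> (0 : X))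
    (u : R -> X) (hreg : regulated T u)
    (e : nat -> R) (he_gt0 : forall k, 0 < e k) (he : e k @[k --> \oo] --> 0)
    (hlim : forall t : R, t \in `[0, T] -> ueps (e k) t @[k --> \oo] --> u t) :
  exists mu : {measure set (measurableTypeR R) -> \bar R},
    [/\ atomic mu, atoms mu = jump_set T u &
      forall s t : R, 0 <= s -> s <= t -> t <= T ->
        ((F t (uplus T u t))%:E + mu `[s, t]%classic =
         (F s (uminus u s))%:E +
           \int[lebesgue_measure]_(r in `[s, t]%classic) (dtF T F r (u r))%:E)%E].
Proof.
have T0 := ltW hT.
pose f (t : R) x := F (clamp T t) x.
pose ft (t : R) x := dtF T F (clamp T t) x.
pose g (t : R) x := gradF ip F (clamp T t) x.
have [dF0 diffF0 cF0 cdtF0 cgF0] := hF0.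
have itvE (t : R) : t \in `[0, T] = (0 <= t <= T) by rewrite in_itv.
have oo_cc (t : R) : 0 < t < T -> 0 <= t <= T by lra.
have cf : continuous (fun p : R * X => f p.1 p.2).
  exact: (continuous_clamp_cylinder hT cF0).
have cft : continuous (fun p : R * X => ft p.1 p.2).
  exact: (continuous_clamp_cylinder hT cdtF0).
have cg : continuous (fun p : R * X => g p.1 p.2).
  exact: (continuous_clamp_cylinder hT cgF0).
have hft (s : R) x : 0 < s < T -> is_derive s 1 (f ^~ x) (ft s x).
  move=> sT; have sT' := oo_cc _ sT; rewrite /ft clampE//.
  by apply: (is_derive_clamped (h := F ^~ x)) => //; apply: dF0; rewrite itvE.
have hfx (t : R) x : 0 < t < T -> differentiable (f t) x.
  by move=> tT; apply: diffF0; exact: clamp_in.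
have hfg (t : R) x y : 0 < t < T -> 'd (f t) x y = ip (g t x) y.
  by move=> _; exact: (gradientP hX).
have hlip := lipschitz_clamped hF3.
have hiso := isolated_clamped hF5.
have hslope := slope_clamped hF5 hF6.
have e_right : e k @[k --> \oo] --> (0 : R)^'+.
  move=> Q [d /= d0 hd]; have : \forall k \near \oo, `|0 - e k| < d.
    by apply: cvgr_dist_lt.
  by apply: filterS => k hk; apply: hd => //=.
have vel : e k *: derive_within `[0, T] (ueps (e k)) 0 @[k --> \oo] --> (0 : X).
  exact: (cvg_comp _ _ e_right hvel).
have [N _ hN] : \forall k \near \oo, `|e k *: derive_within `[0, T] (ueps (e k)) 0| <= 1.
  have /cvgrPdist_le/(_ 1 ltr01) := vel.
  by apply: filterS => k; rewrite sub0r normrN.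
(* Dropping the first [N] terms makes the initial velocities at most 1 for every [k], so the a
   priori bounds hold along the whole sequence. *)
pose e' k := e (k + N)%N.
have e'0 k : 0 < e' k by exact: he_gt0.
have e'cvg : e' k @[k --> \oo] --> (0 : R) by rewrite cvg_shiftn.
have [M0 hM0] := hbnd.
pose v k (t : R) := ueps (e' k) (clamp T t).
pose w k (t : R) := e' k *: derive_within `[0, T] (ueps (e' k)) (clamp T t).
pose dw k (t : R) := e' k *: derive_within `[0, T] (derive_within `[0, T] (ueps (e' k))) t.
have cv k : continuous (v k).
  apply: derivable_within_clamp_continuous => // t tT.
  by have [] := hode _ (e'0 k) t tT.
have cw k : continuous (w k).
  move=> t; apply: cvgZl_tmp.
  apply: (derivable_within_clamp_continuous T0) => r rT.
  by have [] := hode _ (e'0 k) r rT.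
have hv k (t : R) : 0 < t < T -> is_derive t 1 (v k) ((e' k)^-1 *: w k t).
  move=> tT; have tT' := oo_cc _ tT.
  rewrite /w scalerA mulVf ?gt_eqF// scale1r clampE//.
  apply: (@is_derive_near_eq _ _ (ueps (e' k))).
    by apply: filterS (clamp_near tT) => s; rewrite /v => ->.
  by apply: is_derive_within => //; have [] := hode _ (e'0 k) t (etrans (itvE t) tT').
have hw k (t : R) : 0 < t < T -> is_derive t 1 (w k) (dw k t).
  move=> tT; have tT' := oo_cc _ tT.
  apply: is_derive1Z.
  apply: (@is_derive_near_eq _ _ (derive_within `[0, T] (ueps (e' k)))).
    by apply: filterS (clamp_near tT) => s ->.
  by apply: is_derive_within => //; have [] := hode _ (e'0 k) t (etrans (itvE t) tT').
have ode k (t : R) : 0 < t < T -> e' k *: A (dw k t) + B (w k t) + g t (v k t) = 0.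
  move=> tT; have tT' := oo_cc _ tT.
  have [_ _] := hode _ (e'0 k) t (etrans (itvE t) tT').
  by rewrite /dw /w /g /v clampE// !linearZ /= scalerA -expr2.
have [C1 [C2 [C10 C20 hC]]] := hF2.
have hF2' (t : R) x : 0 <= t <= T -> `|ft t x| <= C1 * f t x + C2.
  by move=> tT; apply: hC; exact: clamp_in.
have hF1' (rho : R) : 0 < rho -> exists M : R, forall x,
    (forall t : R, 0 <= t <= T -> `|f t x| <= rho) -> `|x| <= M.
  move=> rho0; have [M [_ hM]] := hF1 rho rho0.
  exists (M + 1) => x hx; apply: (hM (M + 1)); first by rewrite ltrDl.
  apply: ge_sup; first by exists `|F 0 x|, 0 => //=; rewrite in_itv /= lexx.
  move=> _ [t /= tT <-]; rewrite itvE in tT.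
  by have := hx t tT; rewrite /f clampE.
have [M [W hMW]] := solution_bounded hX hT hA hB cf cft hft hfx hfg C10 C20 hF2' hF1' M0.
have {}hMW k := hMW _ _ _ _ (e'0 k) (cv k) (cw k) (hv k) (hw k) (ode k).
have v0 k : `|v k 0| <= M0 by rewrite /v clampE ?lexx//; exact: hM0.
have w0 k : `|w k 0| <= 1.
  by rewrite /w clampE ?lexx//; apply: hN; rewrite /= leq_addl.
have hM k (t : R) : 0 <= t <= T -> `|v k t| <= M by case/(hMW k (v0 k) (w0 k)).
have hW k (t : R) : 0 <= t <= T -> `|w k t| <= W by case/(hMW k (v0 k) (w0 k)).
have hw0 : w k 0 @[k --> \oo] --> (0 : X).
  have := vel; rewrite -(cvg_shiftn N) /w clampE ?lexx//; exact.
have hu (t : R) : 0 <= t <= T -> v k t @[k --> \oo] --> u t.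
  move=> tT; rewrite /v clampE//.
  have := hlim t (etrans (itvE t) tT); rewrite -(cvg_shiftn N); exact.
have hum (t : R) : 0 < t <= T -> forall eta : R, 0 < eta -> exists2 d : R,
    0 < d <= t & forall s, t - d < s < t -> `|u s - uminus u t| < eta.
  move=> tT eta eta0; rewrite /uminus; case/andP: (tT) => t0 _; rewrite t0.
  by apply: cvg_left_dist => //; exact: hreg.2.
have hup (t : R) : 0 <= t < T -> forall eta : R, 0 < eta -> exists2 d : R,
    0 < d <= T - t & forall s, t < s < t + d -> `|u s - uplus T u t| < eta.
  move=> tT eta eta0; rewrite /uplus; case/andP: (tT) => _ t0; rewrite t0.
  by apply: cvg_right_dist => //; exact: hreg.1.
have hum0 : uminus u 0 = u 0 by rewrite /uminus ltxx.
have hupT : uplus T u T = u T by rewrite /uplus ltxx.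
have [P [I [cP dP cvP hint hI]]] := antiderivative_along hX hT cv hM hu cft.
pose fm (t : R) := f t (uminus u t) - I t.
pose fp (t : R) := f t (uplus T u t) - I t.
have [||||mu [amu Jmu muE]] := @jump_measureP _ T fm fp.
- exact: (balance_plus_le hX hT hA hB cf cft hft hfx hfg e'0 e'cvg cv cw hv hw
    ode hM hW hw0 hu hum hup hum0 hupT cP dP cvP hI).
- exact: (balance_nincr hX hT hA hB cf cft hft hfx hfg e'0 e'cvg cv cw hv hw
    ode hM hW hw0 hu hum hup hum0 cP dP cvP hI).
- exact: (balance_right_derivative hX hT cf cft cg hft hlip hslope e'0 e'cvg cv cw
    hv hw ode hM hW hu hum hup hI).
- move=> t eta tT eta0.
  have [d dt hd] := balance_left hX cf cft hM hu hum hup hI tT eta0.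
  by exists d => // s hs; have [] := hd s hs.
exists mu; split=> //.
- rewrite Jmu; apply/seteqP; split=> t [tT].
    move=> lt; split; first by rewrite itvE.
    by move=> E; move: lt; rewrite /fm /fp E ltxx.
  rewrite itvE in tT *; split => //.
  exact: (balance_jump hX hT hA hB cf cft cg hft hfx hfg hiso e'0 e'cvg cv cw hv hw ode
    hM hW hw0 hu hum hup hum0 hupT cP dP cvP hI).
- move=> s t s0 st tT; rewrite muE//.
  have -> : (\int[lebesgue_measure]_(r in `[s, t]%classic) (dtF T F r (u r))%:E =
      \int[lebesgue_measure]_(r in `[s, t]%classic) (ft r (u r))%:E)%E.
    apply: eq_integral => r; rewrite inE /= in_itv /= => /andP[sr rt].
    by rewrite /ft clampE//; lra.
  rewrite hint// -!EFinD /fm /fp /f !clampE; [|lra|lra].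
  by congr (_%:E); lra.
Qed.
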